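(* Let $(\mu_k)_{k\in\mathbb N}$ be an equipartition-consistent random graph model, with $\mu_k$ a probability measure on $\Delta^{k\times k}$. Then there exists a unique random exchangeable probability measure $\mathsf M$ on $[0,1]^2$ such that $\mathrm{Law}(\mathsf G_k[\mathsf M])=\mu_k$ for all $k\in\mathbb N$.
   Context: $\Delta^{k\times k}$: $k\times k$ nonnegative matrices with entries summing to $1$. For $f:[m]\to[k]$ and $G\in\mathbb R^{m\times m}$, $(\rho(f)G)_{i,j}=\sum_{v\in f^{-1}(i),u\in f^{-1}(j)}G_{v,u}$. An equipartition is a map $d:[nk]\to[k]$ all of whose fibers have size $n$. A sequence of probability measures $(\mu_k)$ on $\Delta^{k\times k}$ is an equipartition-consistent random graph model if for all $k,n\in\mathbb N$ and every equipartition $d:[nk]\to[k]$, $X\sim\mu_{nk}$ implies $\rho(d)X\sim\mu_k$. A random probability measure $\mathsf M$ on $[0,1]^2$ is exchangeable if $\mathsf M$ and its pushforward under $(x,y)\mapsto(\sigma(x),\sigma(y))$ are equal in distribution for every Lebesgue-measure-preserving bijection $\sigma:[0,1]\to[0,1]$. $\mathsf G_k[\mathsf M]$ is the random $k\times k$ matrix with entries $\mathsf M(I_i^{(k)}\times I_j^{(k)})$, $I_i^{(k)}=[(i-1)/k,i/k)$. *)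

(* Defs.v *)
From HB Require Import structures.
From mathcomp Require Import all_boot all_order all_algebra.
From mathcomp Require Import all_classical all_reals all_analysis.
Unset Printing Implicit Defensive.
Import Order.TTheory GRing.Theory Num.Theory.
Import numFieldNormedType.Exports.
Local Open Scope classical_set_scope.
Local Open Scope ring_scope.

Section Defs.
Variable R : realType.

Definition mx_coord_sets (k : nat) : set (set 'M[R]_k) :=
  [set S | exists (i j : 'I_k) (B : set R),
     measurable B /\ S = (fun A : 'M[R]_k => A i j) @^-1` B].

Local Notation mxT k := (g_sigma_algebraType (@mx_coord_sets k)).

Definition Delta (k : nat) : set (mxT k) :=
  [set A : 'M[R]_k | (forall i j, 0 <= A i j) /\ \sum_(i < k) \sum_(j < k) A i j = 1].

Definition rho (m k : nat) (f : 'I_m -> 'I_k) (G : mxT m) : mxT k :=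
  \matrix_(i < k, j < k)
     \sum_(v < m | f v == i) \sum_(u < m | f u == j) (G : 'M[R]_m) v u.

Definition equipartition (n k : nat) (d : 'I_(n * k) -> 'I_k) : Prop :=
  forall i : 'I_k, #|[set v | d v == i]| = n.

Arguments rho {m k}.
Arguments equipartition {n k}.

(** Equipartition-consistent random graph model (indices k, n range over
    positive integers; mu 0 is irrelevant). *)
Definition eq_consistent_model (mu : forall k : nat, probability (mxT k) R) :
  Prop :=
  (forall k, (0 < k)%N -> mu k (Delta k) = 1%E) /\
  (forall (k n : nat) (d : 'I_(n * k) -> 'I_k),
      (0 < k)%N -> (0 < n)%N -> equipartition d ->
      forall A : set (mxT k), measurable A ->
        mu (n * k)%N (rho d @^-1` A) = mu k A).


(** Probability measures on R*R, with the evaluation (Giry) sigma-algebra.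
    A random probability measure on [0,1]^2 is described by its law Q,
    a probability on this space concentrated on measures supported by
    [0,1]^2. *)
Definition PM := pprobability (R * R)%type R.

Definition I01 : set R := `[0, 1].

Definition unit_sq : set (R * R) := I01 `*` I01.

Definition lmp_bij (s : R -> R) : Prop :=
  set_bij I01 I01 s /\
  measurable_fun I01 s /\
  (forall A : set R, measurable A -> A `<=` I01 ->
     lebesgue_measure (I01 `&` s @^-1` A) = lebesgue_measure A).

(** (x,y) |-> (s x, s y) on [0,1]^2 (identity outside [0,1] in each
    coordinate, irrelevant for measures supported by [0,1]^2). *)
Definition ext01 (s : R -> R) (x : R) : R :=
  if x \in I01 then s x else x.

Definition Tsq (s : R -> R) (p : R * R) : R * R := (ext01 s p.1, ext01 s p.2).

Definition is_push (s : R -> R) (m m' : PM) : Prop :=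
  forall A : set (R * R), measurable A -> m' A = m (Tsq s @^-1` A).

Definition exchangeable (Q : probability PM R) : Prop :=
  forall s, lmp_bij s ->
  forall B : set PM, measurable B ->
    Q [set m | exists m', is_push s m m' /\ B m'] = Q B.

Definition Ik (k : nat) (i : 'I_k) : set R := `[i%:R / k%:R, i.+1%:R / k%:R[.

Arguments Ik {k}.
Definition Gk (k : nat) (m : PM) : mxT k :=
  \matrix_(i < k, j < k) fine (m (Ik i `*` Ik j)).

Definition represents (mu : forall k : nat, probability (mxT k) R)
  (Q : probability PM R) : Prop :=
  Q [set m : PM | m unit_sq = 1%E] = 1%E /\
  exchangeable Q /\
  (forall k, (0 < k)%N -> forall A : set (mxT k), measurable A ->
     Q (Gk k @^-1` A) = mu k A).

End Defs.
Notation mxT R k := (g_sigma_algebraType (@mx_coord_sets R k)).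
Arguments rho {R m k}.
Arguments equipartition {n k}.
Arguments Ik {R k}.
Arguments eq_consistent_model {R}.
Arguments represents {R}.
Arguments exchangeable {R}.

(* Main.v *)
Require Import Defs.
From HB Require Import structures.
From mathcomp Require Import all_boot all_order all_algebra.
From mathcomp Require Import all_classical all_reals all_analysis.
From mathcomp Require Import measurable_realfun ring lra zify.
Import Order.TTheory GRing.Theory Num.Theory.
Import numFieldNormedType.Exports.
Local Open Scope classical_set_scope.
Local Open Scope ring_scope.

(** The grids of mesh [1 / n!] are nested, so consistency makes the [mu n!] a
projective system. It is realized by random matrices [X n u], [u] uniform on the unit
interval: a nested interval construction generates the sequence of quantized
matrices, and the [X n] are recovered as limits. Given [u], the same construction
applied to the cells of the grids, weighted by [X n u], samples a point of the unit
square; its conditional law given [u] is the random measure.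

By invariance under transpositions each row of a [mu k]-random matrix has mean mass
[1 / k], and likewise for columns. Hence both coordinates of the sampled point are
uniform, and almost surely no mass sits on grid lines, so the random measure has the
grid matrices [X n]. The random mass of a measurable partition [S] into [k] sets of
measure [1 / k] also has law [mu k]: approximate [S] by an equipartition of a fine
grid; the masses change by at most the mass of a strip over a set of small measure,
which is small with high probability by Markov's inequality. For [S] the intervals
[Ik] this gives the laws for all [k], and for [S] the preimages of the cells under a
measure-preserving map it gives exchangeability, because the grid matrices
determine the law of a random measure carried by the unit square. *)

(** * Random matrices: relabelling and comparison of laws *)
Section MatrixSpace.
Set Implicit Arguments.
Unset Strict Implicit.
Variable R : realType.

(** Two things are needed at once: all grid matrices on a single probability space, and a
    conditional law of the sampled point that depends measurably on [u]. A countable alphabet makes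
    both elementary. A word of quantized matrices, or the address of a cell, occupies an interval,
    its probability is the length of that interval, and the interval depends measurably on the
    weights.

    Quantization always rounds down, so its errors have one sign, and limits can be taken as
    suprema. Exact laws are then recovered from approximate ones by right continuity of distribution
    functions.

    Besides being nested, the sizes [n!] are eventually divisible by every [k], so that
    equipartitions of a fine grid into [k] classes exist.

    Grid cells see only the half-open square. The single entry at level [0] is its mass, and this is
    almost surely [1] because [mu 1] lives on [Delta]. Hence the edges at coordinate [1] are null,
    and the proof works with half-open intervals although the statement speaks of closed ones. *)

Lemma measurable_coord k (i j : 'I_k) :
  measurable_fun setT (fun A : mxT R k => (A : 'M[R]_k) i j).
Proof.
move=> _ B mB; rewrite setTI; apply: sub_sigma_algebra.
by exists i, j, B.
Qed.

Lemma measurable_mxT d (T : measurableType d) k (f : T -> mxT R k) :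
  (forall i j, measurable_fun setT (fun x => (f x : 'M[R]_k) i j)) ->
  measurable_fun setT f.
Proof.
move=> mf; apply: (@measurability _ _ T (mxT R k) setT f (@mx_coord_sets R k) erefl).
move=> _ [_ [i [j [B [mB ->]]]] <-].
exact: (mf i j measurableT B mB).
Qed.

Lemma rhoE m k (f : 'I_m -> 'I_k) (A : mxT R m) i j :
  (rho f A : 'M[R]_k) i j =
  \sum_(v < m | f v == i) \sum_(u < m | f u == j) (A : 'M[R]_m) v u.
Proof. by rewrite /rho mxE. Qed.

Lemma measurable_rho m k (f : 'I_m -> 'I_k) :
  measurable_fun setT (rho f : mxT R m -> mxT R k).
Proof.
apply: measurable_mxT => i j; under eq_fun do rewrite rhoE.
under eq_fun do rewrite big_mkcond/=.
apply: measurable_sum => v.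
have [_|_] := boolP (f v == i); last exact: measurable_cst.
under eq_fun do rewrite big_mkcond/=.
apply: measurable_sum => u.
have [_|_] := boolP (f u == j); last exact: measurable_cst.
exact: measurable_coord.
Qed.

Lemma rho_comp l m k (g : 'I_l -> 'I_m) (f : 'I_m -> 'I_k) (A : mxT R l) :
  rho f (rho g A) = rho (f \o g) A.
Proof.
apply/matrixP => i j; rewrite !rhoE.
under eq_bigr do under eq_bigr do rewrite rhoE.
have split_fibers (F : 'I_l -> R) (a : 'I_k) :
    \sum_(v < m | f v == a) \sum_(w < l | g w == v) F w =
    \sum_(w < l | f (g w) == a) F w.
  rewrite (partition_big g (fun v => f v == a))//=.
  apply: eq_bigr => v fv; apply: eq_bigl => w.
  by case: eqP => [->|]; rewrite ?fv ?andbF.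
rewrite -(split_fibers (fun w => \sum_(u < l | f (g u) == j) A w u)).
apply: eq_bigr => v _; rewrite exchange_big/=; apply: eq_bigr => w _.
exact: split_fibers.
Qed.

Lemma rho_ge0 m k (f : 'I_m -> 'I_k) (A : mxT R m) :
  (forall i j, 0 <= (A : 'M[R]_m) i j) -> forall i j, 0 <= (rho f A : 'M[R]_k) i j.
Proof.
by move=> A0 i j; rewrite rhoE; apply: sumr_ge0 => ? _; apply: sumr_ge0.
Qed.

Definition lower_set k (t : 'M[R]_k) : set (mxT R k) :=
  [set A : 'M[R]_k | forall i j, A i j <= t i j].

Lemma measurable_lower_set k (t : 'M[R]_k) : measurable (lower_set t).
Proof.
rewrite [X in measurable X](_ : _ = \bigcap_(i in [set: 'I_k])
  \bigcap_(j in [set: 'I_k])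
   (fun A : mxT R k => (A : 'M[R]_k) i j) @^-1` [set` `]-oo, t i j]]).
  apply: fin_bigcap_measurable => // i _; apply: fin_bigcap_measurable => // j _.
  rewrite -[X in measurable X]setTI.
  by apply: measurable_coord => //; exact: measurable_itv.
apply/seteqP; split => [A/= h i _ j _|A/= h i j].
  by rewrite /= in_itv/= h.
by have := h i I j I; rewrite /= in_itv.
Qed.

Lemma lower_set_setI k (t s : 'M[R]_k) :
  lower_set t `&` lower_set s = lower_set (\matrix_(i, j) Num.min (t i j) (s i j)).
Proof.
apply/seteqP; split => [A [/= h1 h2] i j|A /= h].
  by rewrite mxE le_min h1 h2.
by split => i j; have := h i j; rewrite mxE le_min => /andP[].
Qed.

(** Lower orthants are also closed under intersection, so a law on matrices is determined by its
    multivariate distribution function. *)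
Lemma lower_set_generates k :
  @measurable _ (mxT R k) = <<s range (@lower_set k) >>.
Proof.
rewrite eqEsubset; split.
- apply: smallest_sub; first exact: smallest_sigma_algebra.
  move=> _ [i [j [B [mB ->]]]].
  have : measurable_fun setT
      ((fun A : g_sigma_algebraType (range (@lower_set k)) => (A : 'M[R]_k) i j)).
    apply: (measurability _ (measurable_realfun.RGenOInfty.measurableE R)) => //.
    move=> _ [_ [x ->] <-]; rewrite setTI -[X in measurable X]setCK.
    apply: measurableC.
    (* All entries other than [(i, j)] are bounded by [n], which imposes nothing in the limit: the
       union over [n] is the half-space [A i j <= x]. *)
    pose t n : 'M[R]_k := \matrix_(a, b)
      if (a == i) && (b == j) then x else n%:R.
    rewrite [X in measurable X](_ : _ = \bigcup_n lower_set (t n)); last first.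
      apply/seteqP; split => [A|A [n _ /(_ i j)]]/=; rewrite in_itv/= andbT.
        move=> /negP; rewrite -leNgt => Ax.
        exists (\max_(a < k) \max_(b < k) (Num.truncn (A a b)).+1)%N => // a b.
        rewrite mxE; case: ifPn => [/andP[/eqP -> /eqP ->]//|_].
        rewrite (le_trans (ltW (truncnS_gt _)))// ler_nat.
        by rewrite (leq_trans _ (leq_bigmax a))// (leq_bigmax b).
      by rewrite mxE !eqxx/= => ?; apply/negP; rewrite -leNgt.
    by apply: bigcup_measurable => n _; apply: sub_sigma_algebra; exists (t n).
  by move=> /(_ measurableT B mB); rewrite setTI.
- apply: smallest_sub; first exact: sigma_algebra_measurable.
  by move=> _ [t _ <-]; exact: measurable_lower_set.
Qed.

Lemma probability_ext d (T : measurableType d) (P1 P2 : probability T R)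
    (G : set (set T)) :
  @measurable d T = <<s G >> -> setI_closed G ->
  (forall A, G A -> P1 A = P2 A) -> forall A, measurable A -> P1 A = P2 A.
Proof.
move=> GE GI P12; rewrite [X in forall A, X A -> _]GE.
apply: (@dynkin_induction _ _ G (fun B : set T => P1 B = P2 B)) => //.
- by rewrite !probability_setT.
- by move=> S mS PS; rewrite !probability_setC// PS.
- move=> F mF tF PF; rewrite !measure_bigcup//.
  by apply: eq_eseriesr => n _; exact: PF.
Qed.

Definition shift_mx k (t : 'M[R]_k) (e : R) : 'M[R]_k := \matrix_(i, j) (t i j + e).

Lemma shift_mxE k (t : 'M[R]_k) e i j : shift_mx t e i j = t i j + e.
Proof. by rewrite mxE. Qed.

Lemma le_natV_eps (e : R) : 0 < e -> exists n : nat, n.+1%:R^-1 <= e.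
Proof.
move=> e0; exists (Num.truncn e^-1); rewrite -[leRHS]invrK lef_pV2 ?posrE ?invr_gt0//.
exact/ltW/truncnS_gt.
Qed.

(** Right continuity of the distribution function: the shifted orthants decrease to [lower_set t].
    The vanishing extra term is the error allowed in [law_approx]. *)
Lemma lower_set_shift_cvg k (P : probability (mxT R k) R) (t : 'M[R]_k) :
  (P (lower_set (shift_mx t n.+1%:R^-1)) + (n.+1%:R^-1)%:E @[n --> \oo] -->
   P (lower_set t))%E.
Proof.
rewrite -[X in _ --> X]adde0; apply: cvgeD; first exact: fin_num_adde_defl.
  have -> : lower_set t = \bigcap_n lower_set (shift_mx t n.+1%:R^-1).
    apply/seteqP; split => [A At n _ i j|A At i j].
      by rewrite mxE (le_trans (At i j))// lerDl.
    apply/ler_addgt0Pr => e e0.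
    have [n ne] := le_natV_eps e0.
    by have := At n I i j; rewrite mxE => /le_trans; apply; rewrite lerD2l.
  apply: nonincreasing_cvg_mu.
  - by rewrite (le_lt_trans (probability_le1 _ _)) ?ltry//; exact: measurable_lower_set.
  - by move=> i; exact: measurable_lower_set.
  - by apply: bigcap_measurable => // n _; exact: measurable_lower_set.
  - move=> n m nm; apply/subsetPset => A At i j; have := At i j.
    rewrite !mxE => /le_trans; apply; rewrite lerD2l lef_pV2 ?posrE//.
    by rewrite ler_nat.
apply: cvg_EFin; first by near=> n.
exact: cvg_harmonic.
Unshelve. all: by end_near. Qed.

(** The hypotheses are of Lévy-distance type. They are what remains when two variables are known to
    be close only up to an error [e] and off an event of probability [e]. *)
Lemma law_approx k (P1 P2 : probability (mxT R k) R) :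
  (forall t e, 0 < e ->
     (P1 (lower_set t) <= P2 (lower_set (shift_mx t e)) + e%:E)%E) ->
  (forall t e, 0 < e ->
     (P2 (lower_set t) <= P1 (lower_set (shift_mx t e)) + e%:E)%E) ->
  forall A, measurable A -> P1 A = P2 A.
Proof.
move=> H12 H21; apply: (probability_ext (lower_set_generates k)).
  by move=> _ _ [t _ <-] [s _ <-]; rewrite lower_set_setI; eexists.
suff le_lower (Q1 Q2 : probability (mxT R k) R) :
    (forall t e, 0 < e ->
      (Q1 (lower_set t) <= Q2 (lower_set (shift_mx t e)) + e%:E)%E) ->
    forall t, (Q1 (lower_set t) <= Q2 (lower_set t))%E.
  by move=> _ [t _ <-]; apply/eqP; rewrite eq_le !le_lower.
move=> H t; have h := @lower_set_shift_cvg _ Q2 t.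
rewrite -(cvg_lim _ h)//; apply: lime_ge; first by apply/cvg_ex; eexists; exact: h.
by apply: nearW => n; exact: H.
Qed.

End MatrixSpace.

(** * Nested grids of factorial mesh *)

Section Grid.
Set Implicit Arguments.
Unset Strict Implicit.

(** Grid sizes are written [(fact_pred n).+1], a visible successor, because [inord] and [ord0] need
    an index type of that shape. *)
Definition fact_pred n := (n`!).-1.

Lemma fact_predK n : (fact_pred n).+1 = n`!.
Proof. by rewrite /fact_pred prednK// fact_gt0. Qed.

(* The index [inord] below is always in range when [k.+1] divides [m.+1]. *)
Definition block m k (i : 'I_m.+1) : 'I_k.+1 := inord (i %/ (m.+1 %/ k.+1)).

Lemma dvdn_fact_pred n m : (n <= m)%N ->
  ((fact_pred n).+1 %| (fact_pred m).+1)%N.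
Proof.
move=> nm; rewrite !fact_predK -(ffact_fact (leq_subr n m)) subKn//.
exact: dvdn_mull.
Qed.

Lemma dvdn_fact_pred_lt k n : (k < n)%N -> (k.+1 %| (fact_pred n).+1)%N.
Proof. by move=> kn; rewrite fact_predK; exact: dvdn_fact. Qed.

Lemma blockE m k (i : 'I_m.+1) : (k.+1 %| m.+1)%N ->
  block k i = (i %/ (m.+1 %/ k.+1))%N :> nat.
Proof.
move=> km; rewrite inordK// ltn_divLR; first by rewrite mulnC divnK.
by rewrite divn_gt0// dvdn_leq.
Qed.

Lemma block_comp l m k (i : 'I_l.+1) : (k.+1 %| m.+1)%N -> (m.+1 %| l.+1)%N ->
  block k (block m i) = block k i.
Proof.
move=> km ml; apply/val_inj => /=; rewrite !blockE ?(dvdn_trans km)//.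
rewrite -divnMA; congr (_ %/ _)%N.
by rewrite muln_divA// divnK.
Qed.

Lemma block_itv m k (i : 'I_m.+1) (a : 'I_k.+1) : (k.+1 %| m.+1)%N ->
  (block k i == a) =
  (a * (m.+1 %/ k.+1) <= i < a.+1 * (m.+1 %/ k.+1))%N.
Proof.
move=> km; have q0 : (0 < m.+1 %/ k.+1)%N by rewrite divn_gt0// dvdn_leq.
rewrite -(inj_eq val_inj)/= blockE// -leq_divRL// -ltn_divLR// ltnS.
by rewrite eqn_leq andbC.
Qed.

(** With denominators cleared, this places the cell [[x / m, (x + 1) / m[] inside [[y / k, (y + 1) /
    k[]. *)
Lemma block_bounds x y q k m : (q * k = m)%N -> (y * q <= x)%N -> (x < y.+1 * q)%N ->
  (y * m <= x * k)%N /\ (x.+1 * k <= y.+1 * m)%N.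
Proof. by move=> <-; nia. Qed.

Lemma card_block m k (a : 'I_k.+1) : (k.+1 %| m.+1)%N ->
  #|[set i : 'I_m.+1 | block k i == a]%SET| = (m.+1 %/ k.+1)%N.
Proof.
move=> km; set q := (m.+1 %/ k.+1)%N.
have aq (l : 'I_q) : (a * q + l < m.+1)%N.
  rewrite -(divnK km) -/q mulnC; have := ltn_ord l; have := ltn_ord a; nia.
have -> : [set i : 'I_m.+1 | block k i == a]%SET =
          [set Ordinal (aq l) | l : 'I_q]%SET.
  apply/setP => i; rewrite inE block_itv// -/q; apply/idP/imsetP.
    move=> /andP[ai ia].
    have iq : (i - a * q < q)%N by rewrite ltn_subLR// -mulSnr.
    by exists (Ordinal iq) => //; apply/val_inj => /=; rewrite subnKC.
  by move=> [l _ ->] /=; rewrite leq_addr mulSnr ltn_add2l/=.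
rewrite card_imset ?card_ord// => l l' /(congr1 val)/= /addnI ll'.
exact/val_inj.
Qed.

End Grid.

(** * Consequences of consistency: relabelling invariance and mean row masses *)

Section Consistency.
Set Implicit Arguments.
Unset Strict Implicit.
Variables (R : realType) (mu : forall k : nat, probability (mxT R k) R).
Hypothesis mu_consistent : eq_consistent_model mu.

(** The size is given by an equation because the sizes that occur, factorials and successors, are
    not syntactically products. *)
Lemma mu_rho m k (f : 'I_m -> 'I_k) n : (0 < k)%N -> (0 < n)%N -> m = (n * k)%N ->
  (forall i : 'I_k, #|[set v | f v == i]%SET| = n) ->
  forall A : set (mxT R k), measurable A -> mu m (rho f @^-1` A) = mu k A.
Proof.
move=> k0 n0 mnk; subst m => fn A mA.
apply: (mu_consistent.2 k n f) => // i; rewrite -[RHS](fn i).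
by apply: eq_card => v; apply/idP/idP; rewrite !inE.
Qed.

Lemma mu_block m k : (k.+1 %| m.+1)%N ->
  forall A : set (mxT R k.+1), measurable A ->
    mu m.+1 (rho (@block m k) @^-1` A) = mu k.+1 A.
Proof.
move=> km; apply: (@mu_rho _ _ _ (m.+1 %/ k.+1)) => //.
- by rewrite divn_gt0// dvdn_leq.
- by rewrite divnK.
- by move=> a; exact: card_block.
Qed.

Lemma measurable_Delta k : measurable (@Delta R k).
Proof.
rewrite [X in measurable X](_ : _ =
    (\bigcap_(i in [set: 'I_k]) \bigcap_(j in [set: 'I_k])
       (fun A : mxT R k => (A : 'M[R]_k) i j) @^-1` `[0, +oo[) `&`
    (fun A : mxT R k => \sum_(i < k) \sum_(j < k) (A : 'M[R]_k) i j) @^-1` [set 1]).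
  apply: measurableI.
    apply: fin_bigcap_measurable => // i _; apply: fin_bigcap_measurable => // j _.
    rewrite -[X in measurable X]setTI.
    by apply: measurable_coord => //; exact: measurable_itv.
  rewrite -[X in measurable X]setTI.
  have : measurable_fun setT
    (fun A : mxT R k => \sum_(i < k) \sum_(j < k) (A : 'M[R]_k) i j).
    apply: measurable_sum => i; apply: measurable_sum => j.
    exact: measurable_coord.
  by apply => //; exact: measurable_set1.
apply/seteqP; split => A [A0 A1]; split => //; first by move=> i _ j _;
  rewrite /= in_itv/= A0.
by move=> i j; have := A0 i I j I; rewrite /= in_itv/= andbT.
Qed.

Lemma ae_of_probability1 d (T : measurableType d) (P : probability T R) (D : set T) :
  measurable D -> P D = 1%E -> {ae P, forall x, D x}.
Proof.
move=> mD PD; exists (~` D); split => //; first exact: measurableC.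
by rewrite probability_setC// PD subee.
Qed.

Lemma Delta_ae k : {ae mu k.+1, forall A, @Delta R k.+1 A}.
Proof. by apply: ae_of_probability1; [exact: measurable_Delta|exact: mu_consistent.1]. Qed.

Definition transpose_index k (a b : 'I_k.+1) (i : 'I_k.+1) : 'I_k.+1 :=
  if i == a then b else if i == b then a else i.

Lemma transpose_indexK k (a b : 'I_k.+1) : involutive (transpose_index a b).
Proof.
move=> i; rewrite /transpose_index.
have [->|ia] := eqVneq i a; first by rewrite eqxx; case: eqVneq.
have [->|ib] := eqVneq i b; first by rewrite eqxx.
by rewrite (negbTE ia) (negbTE ib).
Qed.

Lemma rho_involutive k (f : 'I_k -> 'I_k) (A : mxT R k) i j : involutive f ->
  (rho f A : 'M[R]_k) i j = (A : 'M[R]_k) (f i) (f j).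
Proof.
move=> fK; rewrite rhoE (big_pred1 (f i)); last by move=> v; rewrite -(can_eq fK) fK.
by rewrite (big_pred1 (f j))// => v; rewrite -(can_eq fK) fK.
Qed.

(* Relabelling by a transposition shows that all the [g a] have the same mean. *)
Lemma mean_exchangeable k (g : 'I_k.+1 -> mxT R k.+1 -> R) :
  (forall a, measurable_fun setT (g a)) -> (forall a A, 0 <= g a A) ->
  (forall a b A, g a (rho (transpose_index a b) A) = g b A) ->
  (forall A, @Delta R k.+1 A -> \sum_a g a A = 1) ->
  forall a, (\int[mu k.+1]_A (g a A)%:E = (k.+1%:R^-1)%:E)%E.
Proof.
move=> mg g0 gf g1.
have eq_int a b : (\int[mu k.+1]_A (g a A)%:E = \int[mu k.+1]_A (g b A)%:E)%E.
  under [RHS]eq_integral do rewrite -(gf a b).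
  rewrite -(@ge0_integral_pushforward _ _ _ _ _ _ (measurable_rho _) _ setT
    (fun A => (g a A)%:E))//.
  - apply: eq_measure_integral => [|mr B mB _]; first exact: measurable_rho.
    apply/esym.
    (* A transposition is an equipartition with fibers of size one, so consistency makes [mu]
       invariant under it. *)
    apply: (@mu_rho _ _ _ 1%N) => //; first by rewrite mul1n.
    move=> i; rewrite -(card1 (transpose_index a b i)); apply: eq_card => v.
    by rewrite !inE -(can_eq (transpose_indexK a b)) transpose_indexK.
  - exact/measurable_EFinP.
  - by move=> A _; rewrite lee_fin.
move=> a.
have : (\sum_(b < k.+1) \int[mu k.+1]_A (g b A)%:E = 1)%E.
  rewrite -ge0_integral_sum//.
  - rewrite (@ae_eq_integral _ _ _ _ _ (cst 1%E))//.
    + by rewrite integral_cst// mul1e; exact: probability_setT.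
    + by apply: emeasurable_sum => b; exact/measurable_EFinP.
    + apply: filterS (Delta_ae k) => A DA _.
      by rewrite sumEFin g1.
  - by move=> b; exact/measurable_EFinP.
  - by move=> b A _; rewrite lee_fin.
rewrite (eq_bigr (fun=> \int[mu k.+1]_A (g a A)%:E)%E)// => h.
have fin : (\int[mu k.+1]_A (g a A)%:E)%E \is a fin_num.
  rewrite ge0_fin_numE; last by apply: integral_ge0 => A _; rewrite lee_fin.
  apply: (@le_lt_trans _ _ 1%E); last by rewrite ltry.
  rewrite -h big_ord_recl leeDl// sume_ge0// => i _.
  by apply: integral_ge0 => A _; rewrite lee_fin.
move: h; rewrite -(fineK fin) sumEFin sumr_const card_ord => -[h].
congr EFin; apply: (@mulfI _ k.+1%:R); first by rewrite pnatr_eq0.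
by rewrite mulfV ?pnatr_eq0// mulr_natl.
Qed.

(** The absolute values make the integrand nonnegative on all matrices, as [mean_exchangeable] asks;
    on [Delta], which carries [mu], they change nothing. *)
Lemma mean_row k (a : 'I_k.+1) :
  (\int[mu k.+1]_A (\sum_(b < k.+1) `|(A : 'M[R]_k.+1) a b|)%:E = (k.+1%:R^-1)%:E)%E.
Proof.
apply: (mean_exchangeable (g := fun a A => \sum_(b < k.+1) `|(A : 'M[R]_k.+1) a b|)).
- move=> c; apply: measurable_sum => b.
  by apply: measurableT_comp => //; exact: measurable_coord.
- by move=> c A; apply: sumr_ge0.
- move=> c b A; under eq_bigr do rewrite (rho_involutive _ _ _ (transpose_indexK c b)).
  have -> : transpose_index c b c = b by rewrite /transpose_index eqxx.
  rewrite [RHS](reindex_inj (can_inj (transpose_indexK c b)))//.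
- move=> A [A0 A1]; rewrite -[RHS]A1; apply: eq_bigr => c _; apply: eq_bigr => b _.
  by rewrite ger0_norm.
Qed.

Lemma mean_col k (a : 'I_k.+1) :
  (\int[mu k.+1]_A (\sum_(b < k.+1) `|(A : 'M[R]_k.+1) b a|)%:E = (k.+1%:R^-1)%:E)%E.
Proof.
apply: (mean_exchangeable (g := fun a A => \sum_(b < k.+1) `|(A : 'M[R]_k.+1) b a|)).
- move=> c; apply: measurable_sum => b.
  by apply: measurableT_comp => //; exact: measurable_coord.
- by move=> c A; apply: sumr_ge0.
- move=> c b A; under eq_bigr do rewrite (rho_involutive _ _ _ (transpose_indexK c b)).
  have -> : transpose_index c b c = b by rewrite /transpose_index eqxx.
  rewrite [RHS](reindex_inj (can_inj (transpose_indexK c b)))//.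
- move=> A [A0 A1]; rewrite -[RHS]A1 exchange_big; apply: eq_bigr => c _.
  by apply: eq_bigr => b _; rewrite ger0_norm.
Qed.

End Consistency.

(** * A uniform variable generates random words *)
Section Uniform.
Variable R : realType.

(** A measure on the whole line, so that maps need not be restricted to a subtype; the half-open
    interval matches the cells [Ik]. *)
Definition uniform01 (A : set R) : \bar R := lebesgue_measure (A `&` `[0%R, 1%R[).

Let restr : {measure set (measurableTypeR R) -> \bar R} :=
  mrestr (@lebesgue_measure R) (measurable_itv `[0%R, 1%R[).

Let uniform01_set0 : uniform01 set0 = 0%E.
Proof. exact: (measure0 restr). Qed.

Let uniform01_ge0 A : (0 <= uniform01 A)%E.
Proof. exact: (measure_ge0 restr). Qed.

Let uniform01_sigma_additive : semi_sigma_additive uniform01.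
Proof. exact: (@measure_semi_sigma_additive _ _ _ restr). Qed.

HB.instance Definition _ := isMeasure.Build _ R R uniform01
  uniform01_set0 uniform01_ge0 uniform01_sigma_additive.

Let uniform01_setT : uniform01 setT = 1%E.
Proof.
by rewrite /uniform01 setTI lebesgue_measure_itv/= lte_fin ltr01 oppr0 adde0.
Qed.

HB.instance Definition _ :=
  Measure_isProbability.Build _ _ R uniform01 uniform01_setT.

Lemma uniform01_itv (a b : R) : 0 <= a -> a <= b -> b <= 1 ->
  uniform01 `[a, b[ = (b - a)%:E.
Proof.
move=> a0 ab b1; rewrite /uniform01.
have -> : (`[a, b[ `&` `[0, 1[ = `[a, b[)%classic.
  apply/setIidPl => x/=; rewrite !in_itv/= => /andP[ax xb].
  by rewrite (le_trans a0 ax) (lt_le_trans xb b1).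
rewrite lebesgue_measure_itv/= lte_fin; have [ab'|] := ltP a b; first by rewrite EFinB.
by move=> ba; rewrite (_ : b = a) ?subrr//; apply/eqP; rewrite eq_le ba.
Qed.

End Uniform.
Arguments uniform01 {R}.

(** * Random words from nested intervals *)

Section Tree.
Set Implicit Arguments.
Unset Strict Implicit.
Context d (Om : measurableType d) (R : realType).
Variables (N : nat -> nat) (p : seq nat -> Om -> R).

(* Words are stored with their most recent letter first. A word [s] occupies the
   interval of length [p s w] that starts at [left_end s w]. *)
Definition weight_tree (w : Om) := [/\ (forall s, 0 <= p s w), p [::] w = 1,
  (forall s, p s w = \sum_(l < N (size s)) p (val l :: s) w) &
  (forall s l, (N (size s) <= l)%N -> p (l :: s) w = 0)].

Fixpoint left_end (s : seq nat) (w : Om) : R :=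
  if s is a :: s' then left_end s' w + \sum_(l < a) p (val l :: s') w else 0.

(** [left_end (l.+1 :: s)] is the right end of child [l]. The letter is thus the number of children
    lying entirely to the left of [v], a finite count that is measurable in [w] and [v]. *)
Definition next_letter (s : seq nat) (w : Om) (v : R) : nat :=
  (\sum_(l < N (size s)) (left_end (l.+1 :: s) w <= v)%R)%N.

Fixpoint word n (w : Om) (v : R) : seq nat :=
  if n is m.+1 then next_letter (word m w v) w v :: word m w v else [::].

Lemma size_word n w v : size (word n w v) = n.
Proof. by elim: n => //= n ->. Qed.

Section Valid.
Variable w : Om.
Hypothesis tw : weight_tree w.

Let p0 s : 0 <= p s w. Proof. by case: tw. Qed.

Lemma left_endS a s :
  left_end (a.+1 :: s) w = left_end (a :: s) w + p (a :: s) w.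
Proof. by rewrite /= big_ord_recr/= addrA. Qed.

Lemma le_left_end a b s : (a <= b)%N -> left_end (a :: s) w <= left_end (b :: s) w.
Proof.
by move=> /subnKC <-; elim: (b - a)%N => [|n ih]; rewrite ?addn0// addnS left_endS ler_wpDr.
Qed.

Lemma left_end_last s : left_end (N (size s) :: s) w = left_end s w + p s w.
Proof. by case: tw => _ _ /(_ s) -> _. Qed.

Lemma next_letterP s v a : left_end s w <= v < left_end s w + p s w ->
  next_letter s w v = a <->
  left_end (a :: s) w <= v < left_end (a.+1 :: s) w.
Proof.
move=> /andP[sv vs].
have fwd b : left_end (b :: s) w <= v < left_end (b.+1 :: s) w -> next_letter s w v = b.
  move=> /andP[bv vb].
  have bN : (b <= N (size s))%N.
    rewrite leqNgt; apply/negP => Nb.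
    have := le_left_end s (ltnW Nb); rewrite left_end_last => /le_trans /(_ bv).
    by rewrite leNgt vs.
  rewrite /next_letter (eq_bigr (fun l : 'I_(N (size s)) => (l < b)%N : nat)).
    rewrite -big_mkcond/= -(big_ord_widen _ (fun=> 1%N))//.
    by rewrite sum1_card card_ord.
  move=> l _; congr nat_of_bool; have [lb|bl] := ltnP l b.
    by rewrite (le_trans (le_left_end s lb) bv).
  by apply/negbTE; rewrite -ltNge (lt_le_trans vb)// le_left_end.
split=> [|/fwd//].
(* The least child whose right end exceeds [v] contains [v], and by [fwd] it is the letter that was
   read. *)
have exb : exists b, v < left_end (b.+1 :: s) w.
  exists (N (size s)); rewrite (lt_le_trans vs)// -left_end_last.
  exact: le_left_end.
case: (ex_minnP exb) => b vb bmin.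
have bv : left_end (b :: s) w <= v.
  case: b bmin {vb} => [|b] bmin; first by rewrite /= big_ord0 addr0.
  by rewrite leNgt; apply/negP => /bmin; rewrite ltnn.
by rewrite (fwd b) ?bv// => <-; rewrite bv.
Qed.

(** The intervals of the children tile that of their parent, so each induction step is
    [next_letterP] inside the interval of the shorter word. *)
Lemma word_eqP v s : 0 <= v < 1 ->
  word (size s) w v = s <-> left_end s w <= v < left_end s w + p s w.
Proof.
move=> v01; elim: s => [|a s ih]; first by rewrite /= add0r; case: tw => _ -> _ _.
rewrite [word _ _ _]/=; split=> [[+ ws]|].
  by rewrite ws => /next_letterP; rewrite -left_endS; apply; exact/ih.
rewrite -left_endS => av.
(* A letter outside the alphabet has weight zero, hence an empty interval, which cannot contain
   [v]. *)
have aN : (a < N (size s))%N.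
  rewrite ltnNge; apply/negP => Na; case: tw => _ _ _ /(_ s a Na) pa0.
  by move: av; rewrite left_endS pa0 addr0 => /andP[/le_lt_trans h /h]; rewrite ltxx.
have sv : left_end s w <= v < left_end s w + p s w.
  rewrite -left_end_last; case/andP: av => av va; apply/andP; split.
    by rewrite (le_trans _ av)//= lerDl sumr_ge0.
  by rewrite (lt_le_trans va)// le_left_end.
have -> : word (size s) w v = s by exact/ih.
by rewrite (next_letterP a sv).2.
Qed.

Lemma left_end_bounds s : 0 <= left_end s w /\ left_end s w + p s w <= 1.
Proof.
elim: s => [|a s [s0 s1]]; first by rewrite /= add0r; case: tw => _ ->.
split; first by rewrite /= addr_ge0// sumr_ge0.
rewrite -left_endS; have [aN|Na] := ltnP a (N (size s)).
  by rewrite (le_trans (le_left_end s aN))// left_end_last.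
case: tw => _ _ _ /(_ s a Na) pa; rewrite left_endS pa addr0.
rewrite (le_trans _ s1)// -left_end_last.
have : left_end (a :: s) w <= left_end (N (size s) :: s) w; last by [].
elim: a Na {pa} => [|a ih]; first by rewrite leqn0 => /eqP ->.
rewrite leq_eqVlt => /predU1P[<-//|Na]; rewrite left_endS.
by case: tw => _ _ _ /(_ s a Na) ->; rewrite addr0 ih.
Qed.

Lemma word_law s : uniform01 [set v | word (size s) w v = s] = (p s w)%:E.
Proof.
have [s0 s1] := left_end_bounds s.
transitivity (uniform01 `[left_end s w, left_end s w + p s w[%classic).
  rewrite /uniform01; congr (lebesgue_measure _).
  apply/seteqP; split => v [/= sv]; rewrite !in_itv/= => v01; split => //.
    exact/(word_eqP s v01).
  by move: sv; rewrite in_itv/= => /(word_eqP s v01).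
by rewrite uniform01_itv// ?lerDl// addrAC subrr add0r.
Qed.

End Valid.

Hypothesis mp : forall s, measurable_fun setT (p s).

Lemma measurable_left_end s : measurable_fun setT (left_end s).
Proof.
elim: s => [|a s ih] /=; first exact: measurable_cst.
by apply: measurable_funD => //; apply: measurable_sum => l; exact: mp.
Qed.

(** Joint measurability in the parameter and in the uniform variable is what allows the weights
    themselves to be random, as they are when points are sampled. *)
Lemma measurable_word n s : measurable [set x : Om * R | word n x.1 x.2 = s].
Proof.
elim: n s => [|n ih] [|a s] /=.
- by rewrite [X in measurable X](_ : _ = setT)//; apply/seteqP.
- by rewrite [X in measurable X](_ : _ = set0)//; apply/seteqP; split.
- by rewrite [X in measurable X](_ : _ = set0)//; apply/seteqP; split.
have mnl : measurable_fun setT (fun x : Om * R =>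
    \sum_(l < N (size s)) if left_end (l.+1 :: s) x.1 <= x.2 then 1 else 0 : R).
  apply: measurable_sum => l; apply: measurable_fun_ifT => //.
  apply: measurable_fun_ler => //.
  by apply: measurableT_comp => //; exact: measurable_left_end.
rewrite [X in measurable X](_ : _ = [set x | word n x.1 x.2 = s] `&`
  ((fun x : Om * R =>
    \sum_(l < N (size s)) if left_end (l.+1 :: s) x.1 <= x.2 then 1 else 0 : R)
    @^-1` [set a%:R])).
  apply: measurableI; first exact: ih.
  by rewrite -[X in measurable X]setTI; exact: mnl.
have sumE x : \sum_(l < N (size s)) (if left_end (l.+1 :: s) x.1 <= x.2 then 1 else 0 : R)
    = (next_letter s x.1 x.2)%:R.
  by rewrite natr_sum; apply: eq_bigr => l _; case: ifP.
apply/seteqP; split => x /=.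
  by move=> [+ ws]; rewrite ws => nl; split=> //; rewrite sumE nl.
by move=> [-> /eqP]; rewrite sumE eqr_nat => /eqP ->.
Qed.

Lemma measurable_word_set n (W : set (seq nat)) :
  measurable [set x : Om * R | W (word n x.1 x.2)].
Proof.
rewrite [X in measurable X](_ : _ = \bigcup_(s in W) [set x | word n x.1 x.2 = s]).
  rewrite bigcup_mkcond; apply: countable_bigcupT_measurable => // s.
  by case: ifP => // _; exact: measurable_word.
apply/seteqP; split => [x Wx|x [s Ws /= ->//]].
by exists (word n x.1 x.2).
Qed.

End Tree.

(** Any [W] is a countable union of points, so agreement on points suffices; [pickle] numbers them
    for the countable sum. *)
Lemma eq_law_countable d1 d2 (T1 : measurableType d1) (T2 : measurableType d2)
    (R : realType) (I : countType)
    (P1 : {measure set T1 -> \bar R}) (P2 : {measure set T2 -> \bar R})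
    (f : T1 -> I) (g : T2 -> I) :
  (forall i, measurable (f @^-1` [set i])) -> (forall i, measurable (g @^-1` [set i])) ->
  (forall i, P1 (f @^-1` [set i]) = P2 (g @^-1` [set i])) ->
  forall W, P1 (f @^-1` W) = P2 (g @^-1` W).
Proof.
move=> mf mg fg W.
pose D : set nat := [set pickle i | i in W].
pose F T (h : T -> I) n : set T := [set t | pickle (h t) = n].
have FE T (h : T -> I) i : F T h (pickle i) = h @^-1` [set i].
  by apply/seteqP; split => t; rewrite /F/=; [move/(pcan_inj pickleK)|move=> ->].
have DE T (h : T -> I) : h @^-1` W = \bigcup_(n in D) F T h n.
  apply/seteqP; split => [t /= Wt|t [_ [i Wi <-]]].
    by exists (pickle (h t)) => //; exists (h t).
  by rewrite FE => /= ->.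
have tF T (h : T -> I) : trivIset D (F T h).
  by move=> i j _ _ [t [/= <- <-]].
rewrite !DE !measure_bigcup//.
- by apply: eq_eseriesr => _ /set_mem[i _ <-]; rewrite !FE.
- by move=> _ [i _ <-]; rewrite FE.
- by move=> _ [i _ <-]; rewrite FE.
Qed.

(** * A consistent family of random matrices *)
Section Auxiliary.
Set Implicit Arguments.
Unset Strict Implicit.

Lemma measure_partition d (T : measurableType d) (R : realType)
    (P : {measure set T -> \bar R}) (I : finType) (f : T -> I) (A : set T) :
  measurable A -> (forall i, measurable (f @^-1` [set i])) ->
  P A = (\sum_(i : I) P (A `&` f @^-1` [set i]))%E.
Proof.
move=> mA mf; transitivity (\sum_(i \in [set: I]) P (A `&` f @^-1` [set i]))%E; last first.
  have -> : [set: I] = [set` index_enum I].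
    by apply/seteqP; split => // i _ /=; exact: mem_index_enum.
  by rewrite -fsbig_seq// index_enum_uniq.
rewrite -measure_fin_bigcup//=.
- congr (P _); rewrite -setI_bigcupr; apply/esym/setIidPl => x _.
  by exists (f x).
- by move=> i j _ _ [x /= [[_ <-] [_ <-]]].
- by move=> i _; exact: measurableI.
Qed.

Lemma measurable_truncn (R : realType) : measurable_fun setT (@Num.truncn R).
Proof.
move=> _ Y _; rewrite setTI.
rewrite [X in measurable X](_ : _ = \bigcup_(n in Y) (@Num.truncn R @^-1` [set n])).
  apply: bigcup_measurable => n _.
  rewrite [X in measurable X](_ : _ = `]-oo, n.+1%:R[%classic `\`
     (if n is m.+1 then `]-oo, m.+1%:R[%classic else set0)).
    by apply: measurableD => //; case: n.
  apply/seteqP; split => x /=.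
    move=> xn; rewrite in_itv/= -Num.Theory.truncn_le_nat xn leqnn; split => //.
    case: n xn => [_ []|n xn]; rewrite /= in_itv/= -Num.Theory.truncn_le_nat xn.
    by rewrite ltnn.
  case: n => [|n] [] /=; rewrite in_itv/= -Num.Theory.truncn_le_nat.
    by rewrite leqn0 => /eqP.
  move=> xn; rewrite in_itv/= -Num.Theory.truncn_le_nat => /negP; rewrite -ltnNge => nx.
  by apply/eqP; rewrite eqn_leq xn.
by apply/seteqP; split => [x Yx|x [n Yn /= ->//]]; exists (Num.truncn x).
Qed.

Lemma le_measure_ae d (T : measurableType d) (R : realType)
    (P : {measure set T -> \bar R}) (A B : set T) :
  measurable A -> measurable B -> {ae P, forall x, A x -> B x} -> (P A <= P B)%E.
Proof.
move=> mA mB [N [mN PN AB]].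
suff ABN : (P A <= P (B `|` N))%E.
  rewrite (le_trans ABN)// -[leRHS]adde0 -PN; exact: measureU2.
apply: le_measure; rewrite ?inE//; first exact: measurableU.
move=> x Ax; have [Bx|nBx] := pselect (B x); first by left.
by right; apply: AB => /= /(_ Ax).
Qed.

Lemma eq_measure_ae d (T : measurableType d) (R : realType)
    (P : {measure set T -> \bar R}) (A B : set T) :
  measurable A -> measurable B -> {ae P, forall x, A x <-> B x} -> P A = P B.
Proof.
move=> mA mB AB; apply/eqP; rewrite eq_le !le_measure_ae//.
  by apply: filterS AB => x [].
by apply: filterS AB => x [].
Qed.

Lemma sum_rho (R : realType) m k (f : 'I_m -> 'I_k) (A : mxT R m) :
  \sum_i \sum_j (rho f A : 'M[R]_k) i j = \sum_v \sum_u (A : 'M[R]_m) v u.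
Proof.
under eq_bigr do under eq_bigr do rewrite rhoE.
rewrite [RHS](partition_big f xpredT)//=; apply: eq_bigr => i _.
rewrite exchange_big/=; apply: eq_bigr => v _.
by rewrite [RHS](partition_big f xpredT).
Qed.

Lemma Delta_rho (R : realType) m k (f : 'I_m -> 'I_k) (A : mxT R m) :
  Delta R m A -> Delta R k (rho f A).
Proof.
by move=> [A0 A1]; split; [exact: rho_ge0|rewrite sum_rho].
Qed.

(** An entry of the relabelled matrix sums at most [m ^ 2] entries. The errors keep their sign,
    which later allows suprema instead of limits. *)
Lemma rho_close (R : realType) m k (f : 'I_m -> 'I_k) (A B : mxT R m) (e : R) :
  (forall i j, 0 <= (A : 'M[R]_m) i j - (B : 'M[R]_m) i j <= e) ->
  forall i j, 0 <= (rho f A : 'M[R]_k) i j - (rho f B : 'M[R]_k) i j <= (m ^ 2)%:R * e.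
Proof.
move=> AB i j; rewrite !rhoE -sumrB.
under eq_bigr do rewrite -sumrB.
apply/andP; split.
  by apply: sumr_ge0 => v _; apply: sumr_ge0 => u _; case/andP: (AB v u).
have [m0|m0] := posnP m.
  by subst m; rewrite big_pred0 ?mul0r// => -[].
have e0 : 0 <= e by case/andP: (AB (Ordinal m0) (Ordinal m0)); exact: le_trans.
apply: (@le_trans _ _ (\sum_(v < m) \sum_(u < m) e)).
  rewrite [leRHS](bigID (fun v => f v == i))/= ler_wpDr//.
    by apply: sumr_ge0 => v _; apply: sumr_ge0.
  apply: ler_sum => v _.
  rewrite [leRHS](bigID (fun u => f u == j))/= ler_wpDr//.
    by apply: sumr_ge0.
  by apply: ler_sum => u _; case/andP: (AB v u).
by rewrite !sumr_const !card_ord -mulrnA mulr_natl mulnn.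
Qed.

Lemma Delta_le1 (R : realType) k (A : mxT R k) : Delta R k A ->
  forall i j, (A : 'M[R]_k) i j <= 1.
Proof.
move=> [A0 A1] i j; rewrite -A1 (bigD1 i)//= (bigD1 j)//= -addrA lerDl.
by rewrite addr_ge0// sumr_ge0// => *; rewrite ?sumr_ge0.
Qed.

End Auxiliary.

Section RandomMatrices.
Set Implicit Arguments.
Unset Strict Implicit.
Variables (R : realType) (mu : forall k : nat, probability (mxT R k) R).
Hypothesis mu_consistent : eq_consistent_model mu.

Local Notation K n := (fact_pred n).+1.
(* [coarsen] adds up at most [(K n) ^ 2] entries, so that quantizing at precision
   [1 / prec n] perturbs every coarsening of the [n]-th matrix by at most [1 / n.+1]. *)
Local Notation prec n := ((K n) ^ 2 * n.+1)%N.

Definition coarsen m j : mxT R (K m) -> mxT R (K j) :=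
  rho (@block (fact_pred m) (fact_pred j)).

Lemma coarsen_comp l m j (A : mxT R (K l)) : (j <= m)%N -> (m <= l)%N ->
  coarsen j (coarsen m A) = coarsen j A.
Proof.
move=> jm ml; rewrite /coarsen rho_comp; congr (rho _ A); apply/funext => i /=.
by rewrite block_comp// dvdn_fact_pred.
Qed.

Lemma mu_coarsen m j (B : set (mxT R (K j))) : (j <= m)%N -> measurable B ->
  mu (K m) (@coarsen m j @^-1` B) = mu (K j) B.
Proof. by move=> jm mB; rewrite mu_block// dvdn_fact_pred. Qed.

Lemma measurable_coarsen m j : measurable_fun setT (@coarsen m j).
Proof. exact: measurable_rho. Qed.

(** An entry of a matrix in [Delta] may equal [1], so truncation takes the value [prec n] too; hence
    the successor. *)
Definition quant_type n : finType := {ffun 'I_(K n) * 'I_(K n) -> 'I_(prec n).+1}.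

Definition quant n (A : mxT R (K n)) : quant_type n :=
  [ffun ij => inord (Num.truncn ((prec n)%:R * (A : 'M[R]_(K n)) ij.1 ij.2))].

Definition code n (A : mxT R (K n)) : nat := enum_rank (quant A).

Definition decode n (c : nat) : mxT R (K n) := \matrix_(i, j)
  ((nth [ffun=> ord0] (enum (quant_type n)) c (i, j))%:R / (prec n)%:R).

Lemma prec_gt0 n : (0 < (prec n)%:R :> R).
Proof. by rewrite ltr0n muln_gt0 expn_gt0. Qed.

Lemma decode_code n (A : mxT R (K n)) : Delta R (K n) A -> forall i j,
  0 <= (A : 'M[R]_(K n)) i j - (decode n (code A) : 'M[R]_(K n)) i j <= (prec n)%:R^-1.
Proof.
move=> DA i j; have [A0 _] := DA; have A1 := Delta_le1 DA i j.
rewrite mxE /code nth_enum_rank ffunE /=; have p0 := prec_gt0 n.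
set x := (prec n)%:R * _; have x0 : 0 <= x by rewrite mulr_ge0// ltW.
rewrite inordK; last first.
  rewrite ltnS Num.Theory.truncn_le_nat (@le_lt_trans _ _ (prec n)%:R)//.
    by rewrite /x ler_piMr// ltW.
  by rewrite ltr_nat.
have /andP[lx xl] := truncn_itv x0.
rewrite -[X in X - _](mulfK (lt0r_neq0 p0)) (mulrC _ (prec n)%:R) -/x -mulrBl.
apply/andP; split; first by rewrite mulr_ge0 ?subr_ge0// invr_ge0 ltW.
rewrite -[leRHS]mul1r ler_wpM2r ?invr_ge0 1?ltW// ltrBlDr addrC.
by rewrite -natr1 in xl.
Qed.

Lemma measurable_code n (c : nat) : measurable (@code n @^-1` [set c]).
Proof.
have mq (q : quant_type n) : measurable (@quant n @^-1` [set q]).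
  rewrite [X in measurable X](_ : _ = \bigcap_(ij in [set: 'I_(K n) * 'I_(K n)])
    ((fun A : mxT R (K n) => Num.truncn ((prec n)%:R * (A : 'M[R]_(K n)) ij.1 ij.2))
      @^-1` [set l | inord l = q ij])); last first.
    apply/seteqP; split => [A /= <- ij _|A h]; first by rewrite /= ffunE.
    by apply/ffunP => ij; rewrite ffunE; exact: h.
  apply: fin_bigcap_measurable => // ij _; rewrite -[X in measurable X]setTI.
  apply: (measurableT_comp (@measurable_truncn R)) => //.
  by apply: measurable_funM => //; exact: measurable_coord.
rewrite [X in measurable X](_ : _ =
  \bigcup_(q in [set q : quant_type n | enum_rank q = c :> nat]) (@quant n @^-1` [set q])).
  by apply: fin_bigcup_measurable => //; exact: finite_finset.
by apply/seteqP; split => [A <-|A [q <- <-]] //; exists (quant A).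
Qed.

(** The levels below [n] are recorded, most recent first as in [word]. The matrix itself is not, so
    a history has length [n] and the one at level [0] is empty. *)
Fixpoint hist n : mxT R (K n) -> seq nat :=
  if n is m.+1 then fun A => code (coarsen m A) :: hist (coarsen m A) else fun=> [::].

Lemma size_hist n (A : mxT R (K n)) : size (hist A) = n.
Proof. by elim: n A => //= n ih A; rewrite ih. Qed.

Lemma hist_cons n c s : @hist n.+1 @^-1` [set c :: s] =
  @coarsen n.+1 n @^-1` (@hist n @^-1` [set s] `&` @code n @^-1` [set c]).
Proof. by apply/seteqP; split => A /= [-> ->]. Qed.

Lemma measurable_hist n s : measurable (@hist n @^-1` [set s]).
Proof.
elim: n s => [|n ih] [|c s].
- by rewrite [X in measurable X](_ : _ = setT)//; apply/seteqP.
- by rewrite [X in measurable X](_ : _ = set0)//; apply/seteqP; split.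
- by rewrite [X in measurable X](_ : _ = set0)//; apply/seteqP; split.
rewrite hist_cons -[X in measurable X]setTI; apply: measurable_coarsen => //.
by apply: measurableI; [exact: ih|exact: measurable_code].
Qed.

Lemma measurable_hist_set n (W : set (seq nat)) : measurable (@hist n @^-1` W).
Proof.
rewrite [X in measurable X](_ : _ = \bigcup_(s in W) (@hist n @^-1` [set s])).
  rewrite bigcup_mkcond; apply: countable_bigcupT_measurable => // s.
  by case: ifP => // _; exact: measurable_hist.
by apply/seteqP; split => [A WA|A [s Ws /= ->//]]; exists (hist A).
Qed.

(** These weights are deterministic, so the parameter space of the tree is [unit]. *)
Definition hist_weight (s : seq nat) (_ : unit) : R :=
  fine (mu (K (size s)) (@hist (size s) @^-1` [set s])).

Lemma hist_weightE s n : size s = n ->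
  (hist_weight s tt)%:E = mu (K n) (@hist n @^-1` [set s]).
Proof.
move=> <-; rewrite /hist_weight fineK//; apply: fin_num_measure.
exact: measurable_hist.
Qed.

(** Additivity is consistency of [mu]. The event of history [c :: s] is a preimage under [coarsen],
    so its probability can be computed one level lower, where the codes [c] partition the event of
    history [s]. *)
Lemma hist_weight_tree :
  weight_tree (fun n => #|quant_type n|) hist_weight tt.
Proof.
split.
- by move=> s; rewrite fine_ge0.
- apply: EFin_inj; rewrite (@hist_weightE _ 0%N)//.
  rewrite [X in mu _ X](_ : _ = setT) ?probability_setT//.
  by apply/seteqP.
- move=> s; apply: EFin_inj; rewrite (hist_weightE (n := size s))//.
  rewrite (@measure_partition _ _ _ _ _ (fun A => enum_rank (quant A))); last 2 first.
    exact: measurable_hist.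
    move=> i; rewrite [X in measurable X](_ : _ = @code (size s) @^-1` [set val i]).
      exact: measurable_code.
    by apply/seteqP; split => A /=; [move=> <-|move/val_inj].
  rewrite -sumEFin; apply: eq_bigr => l _.
  rewrite (@hist_weightE (val l :: s) (size s).+1)// hist_cons mu_coarsen//.
    congr (mu _ (_ `&` _)); apply/seteqP.
    by split => A /=; [move=> <-|exact: val_inj].
  by apply: measurableI; [exact: measurable_hist|exact: measurable_code].
- move=> s l Nl; apply: EFin_inj; rewrite (@hist_weightE (l :: s) (size s).+1)//.
  rewrite [X in mu _ X](_ : _ = set0) ?measure0//.
  apply/seteqP; split => // A /= [cl _]; move: Nl; rewrite -cl leqNgt.
  by rewrite /code ltn_ord.
Qed.

Definition rword n (v : R) : seq nat :=
  word (fun n => #|quant_type n|) hist_weight n tt v.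

Lemma measurable_rword n (W : set (seq nat)) : measurable (rword n @^-1` W).
Proof.
have mW : measurable [set x : unit * R |
    W (word (fun n => #|quant_type n|) hist_weight n x.1 x.2)].
  by apply: measurable_word_set => s; exact: measurable_cst.
have := measurable_xsection tt mW.
rewrite [X in measurable X -> _](_ : _ = rword n @^-1` W)//.
by apply/seteqP; split => v; rewrite /xsection/= inE.
Qed.

Lemma rword_law n (W : set (seq nat)) :
  uniform01 (rword n @^-1` W) = mu (K n) (@hist n @^-1` W).
Proof.
apply: eq_law_countable => [s|s|s].
- exact: measurable_rword.
- exact: measurable_hist.
have [<-|sn] := eqVneq (size s) n.
  exact: etrans (word_law hist_weight_tree s) (hist_weightE erefl).
have -> : rword n @^-1` [set s] = set0.
  by apply/seteqP; split => // v /= sv; move: sn; rewrite -sv size_word eqxx.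
have -> : @hist n @^-1` [set s] = set0.
  by apply/seteqP; split => // A /= sA; move: sn; rewrite -sA size_hist eqxx.
exact: etrans (measure0 _) (esym (measure0 _)).
Qed.

(** Words grow at the head. Counting from the far end makes the letter of level [i] independent of
    how far the word has been continued. *)
Definition letter i (s : seq nat) := nth 0%N s (size s - i.+1).

Lemma letter_hist N i (A : mxT R (K N)) : (i < N)%N ->
  letter i (hist A) = code (coarsen i A).
Proof.
elim: N A => // N ih A; rewrite ltnS /letter /= size_hist subSS => iN.
have [->|iN'] := eqVneq i N; first by rewrite subnn.
have {}iN : (i < N)%N by rewrite ltn_neqAle iN'.
rewrite -[(N - i)%N]prednK ?subn_gt0//= -subnS.
have := ih (coarsen N A) iN; rewrite /letter size_hist => ->.
by rewrite coarsen_comp// ltnW.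
Qed.

Lemma letter_rword N i v : (i < N)%N -> letter i (rword N v) = letter i (rword i.+1 v).
Proof.
elim: N => // N ih; rewrite ltnS leq_eqVlt => /predU1P[->//|iN].
rewrite -ih// {1}/letter {1}/rword [word _ _ N.+1]/= -/(rword N v).
rewrite /= size_word subSS /letter size_word.
by rewrite subnS -[(N - i)%N]prednK ?subn_gt0//= -subnS.
Qed.

Definition approx m j (s : seq nat) : mxT R (K j) := coarsen j (decode m (letter m s)).

Lemma approx_hist N m j (A : mxT R (K N)) : (j <= m)%N -> (m < N)%N ->
  Delta R (K N) A -> forall a b,
  0 <= (coarsen j A : 'M[R]_(K j)) a b - (approx m j (hist A) : 'M[R]_(K j)) a b
    <= m.+1%:R^-1.
Proof.
move=> jm mN DA a b; rewrite /approx letter_hist// -(coarsen_comp _ jm (ltnW mN)).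
have Dm : Delta R (K m) (coarsen m A) by exact: Delta_rho.
have := rho_close (@block (fact_pred m) (fact_pred j)) (decode_code Dm) a b.
by rewrite natrM invfM mulrA mulfV ?mul1r// pnatr_eq0 expn_eq0.
Qed.

(** For the history of a matrix in [Delta], the first approximation lies below the coarsened matrix,
    which exceeds the second by at most [1 / (m + 1)]. The resulting comparison mentions the history
    alone, so [rword_law] transfers it to random words. *)
Lemma approx_approx j m m' : (j <= m)%N -> (j <= m')%N ->
  {ae uniform01, forall v, forall a b,
   (approx m' j (rword m'.+1 v) : 'M[R]_(K j)) a b <=
   (approx m j (rword m.+1 v) : 'M[R]_(K j)) a b + m.+1%:R^-1}.
Proof.
move=> jm jm'; pose N := (maxn m m').+1.
pose W := [set s : seq nat | forall a b,
   (approx m' j s : 'M[R]_(K j)) a b <= (approx m j s : 'M[R]_(K j)) a b + m.+1%:R^-1].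
have : {ae uniform01, forall v, W (rword N v)}.
  apply: (@ae_of_probability1 _ _ _ uniform01 (rword N @^-1` W)).
    exact: measurable_rword.
  rewrite [LHS](_ : _ = mu (K N) (@hist N @^-1` W)); last exact: rword_law.
  apply/eqP; rewrite eq_le probability_le1/=; last first.
    exact: measurable_hist_set.
  rewrite -(mu_consistent.1 (K N))//; apply: le_measure; rewrite ?inE.
  - exact: measurable_Delta.
  - exact: measurable_hist_set.
  move=> A DA a b.
  have /andP[_ h1] := approx_hist jm (leq_maxl m m' : (m < N)%N) DA a b.
  have /andP[h2 _] := approx_hist jm' (leq_maxr m m' : (m' < N)%N) DA a b.
  by rewrite subr_ge0 in h2; rewrite lerBlDl in h1; exact: le_trans h2 h1.
apply: filterS => v h a b; have := h a b.
by rewrite /approx !(@letter_rword N)// ltnS ?leq_maxl ?leq_maxr.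
Qed.

(** By [approx_approx] the supremum is almost surely within [1 / (m + 1)] of each approximation, so
    it is their limit. The levels start at [j] because only those can be coarsened to level [j]. *)
Definition limit_matrix j (v : R) : mxT R (K j) := \matrix_(a, b)
  fine (esups (fun m => ((approx (j + m) j (rword (j + m).+1 v) : 'M[R]_(K j)) a b)%:E) 0).

Lemma measurable_approx m j a b :
  measurable_fun setT (fun v => (approx m j (rword m.+1 v) : 'M[R]_(K j)) a b).
Proof.
move=> _ Y mY; rewrite setTI.
exact: (measurable_rword _ [set s | Y ((approx m j s : 'M[R]_(K j)) a b)]).
Qed.

Lemma measurable_limit_matrix j : measurable_fun setT (limit_matrix j).
Proof.
apply: measurable_mxT => a b; under eq_fun do rewrite mxE.
apply: measurableT_comp => //; apply: measurable_fun_esups => m.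
by apply/measurable_EFinP; exact: measurable_approx.
Qed.

Lemma limit_matrix_approx : {ae uniform01, forall v, forall j m, (j <= m)%N -> forall a b,
  (approx m j (rword m.+1 v) : 'M[R]_(K j)) a b <= (limit_matrix j v : 'M[R]_(K j)) a b <=
  (approx m j (rword m.+1 v) : 'M[R]_(K j)) a b + m.+1%:R^-1}.
Proof.
apply: ae_foralln => j.
have : {ae uniform01, forall v, forall m m', forall a b,
   (approx (j + m') j (rword (j + m').+1 v) : 'M[R]_(K j)) a b <=
   (approx (j + m) j (rword (j + m).+1 v) : 'M[R]_(K j)) a b + (j + m).+1%:R^-1}.
  apply: ae_foralln => m; apply: ae_foralln => m'.
  by apply: approx_approx; rewrite leq_addr.
apply: filterS => v h m jm a b.
pose u m := (((approx (j + m) j (rword (j + m).+1 v) : 'M[R]_(K j)) a b)%:E).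
have -> : (limit_matrix j v : 'M[R]_(K j)) a b = fine (esups u 0).
  by rewrite /limit_matrix mxE.
rewrite -(subnKC jm); set i := (m - j)%N.
have u1 : ((u i) <= esups u 0%N)%E by apply: ereal_sup_ubound; exists i.
have u2 : (esups u 0%N <= u i + ((j + i).+1%:R^-1)%:E)%E.
  by apply: ge_ereal_sup => _ [l _ <-]; rewrite /u -EFinD lee_fin h.
have fu : esups u 0%N \is a fin_num.
  by rewrite fin_numElt (lt_le_trans _ u1) ?ltNyr// (le_lt_trans u2)// -EFinD ltry.
by move: u1 u2; rewrite -(fineK fu) -EFinD !lee_fin => -> ->.
Qed.

Let norm_sub_le (x y z c d e : R) : y <= z -> z <= y + c -> 0 <= x - y ->
  x - y <= d -> c <= d -> d <= e -> `|x - z| <= e.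
Proof. by move=> *; rewrite ler_norml; apply/andP; split; lra. Qed.

Let le_addr_trans (x y c t e : R) : x - y <= c -> y <= t -> c <= e -> x <= t + e.
Proof. by move=> *; lra. Qed.

(** Coarsening [approx m l] gives [approx m j]. Both matrices are therefore within [C / (m + 1)] of
    it, where [C] is the factor in [rho_close], and [m] is arbitrary. *)
Lemma limit_matrix_consistent : {ae uniform01, forall v, forall j l, (j <= l)%N ->
  coarsen j (limit_matrix l v) = limit_matrix j v}.
Proof.
apply: filterS limit_matrix_approx => v h j l jl; apply/matrixP => a b.
apply/eqP; rewrite -subr_eq0 -normr_eq0; apply/eqP/le_anti; rewrite normr_ge0 andbT.
apply/ler_addgt0Pr => e e0; rewrite add0r.
pose C : R := ((K l) ^ 2)%:R.
have C1 : 1 <= C by rewrite ler1n expn_gt0.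
have [n ne] := le_natV_eps (divr_gt0 e0 (lt_le_trans ltr01 C1)).
pose m := maxn l n.
have lm : (l <= m)%N := leq_maxl _ _.
have mn : m.+1%:R^-1 <= n.+1%:R^-1 :> R.
  by rewrite lef_pV2 ?posrE// ler_nat ltnS leq_maxr.
have /andP[h1 h2] := h j m (leq_trans jl lm) a b.
have hl a' b' : 0 <= (limit_matrix l v : 'M[R]_(K l)) a' b' -
    (approx m l (rword m.+1 v) : 'M[R]_(K l)) a' b' <= m.+1%:R^-1.
  by rewrite subr_ge0 lerBlDl; exact: h.
have := rho_close (@block (fact_pred l) (fact_pred j)) hl a b.
rewrite -/(coarsen j (limit_matrix l v)) -/(coarsen j (approx m l (rword m.+1 v))).
rewrite /approx coarsen_comp// -/(approx m j (rword m.+1 v)) -/C => /andP[h3 h4].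
have Ce : C * m.+1%:R^-1 <= e.
  rewrite (le_trans (ler_wpM2l _ (le_trans mn ne))) ?(le_trans ler01)//.
  by rewrite mulrC divfK// gt_eqF// (lt_le_trans ltr01).
have Cm : m.+1%:R^-1 <= C * m.+1%:R^-1 by rewrite ler_peMl.
exact: (norm_sub_le h1 h2 h3 h4 Cm Ce).
Qed.

Lemma limit_matrix_law j (A : set (mxT R (K j))) : measurable A ->
  uniform01 (limit_matrix j @^-1` A) = mu (K j) A.
Proof.
move: A; pose X : {mfun R >-> mxT R (K j)} :=
  HB.pack (limit_matrix j) (isMeasurableFun.Build _ _ _ _ _ (@measurable_limit_matrix j)).
apply: (@law_approx _ _ (distribution uniform01 X) (mu (K j))) => t e e0.
all: have [n ne] := le_natV_eps e0; pose m := maxn j n.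
all: have jm : (j <= m)%N := leq_maxl _ _.
all: have me : m.+1%:R^-1 <= e by
  rewrite (le_trans _ ne)// lef_pV2 ?posrE// ler_nat ltnS leq_maxr.
(* Letter [m] first appears in words of length [m.+1]. The approximation is a function of the word,
   so it has the same law for random words as for histories, and the latter are close to coarsened
   [mu]-random matrices. *)
all: have approxE s : uniform01 [set v | lower_set s (approx m j (rword m.+1 v))] =
  mu (K m.+1) [set A | lower_set s (approx m j (hist A))] by
  exact: (rword_law m.+1 [set w | lower_set s (approx m j w)]).
all: have coarsenE s : mu (K m.+1) [set A | lower_set s (coarsen j A)] =
  mu (K j) (lower_set s) by
  apply: mu_coarsen; [exact: leqW|exact: measurable_lower_set].
all: have mapprox s : measurable [set v | lower_set s (approx m j (rword m.+1 v))] by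
  exact: (measurable_rword _ [set w | lower_set s (approx m j w)]).
all: have mhist s : measurable [set A : mxT R (K m.+1) | lower_set s (approx m j (hist A))] by
  exact: (measurable_hist_set [set w | lower_set s (approx m j w)]).
all: have mcoarsen s : measurable [set A : mxT R (K m.+1) | lower_set s (coarsen j A)] by
  rewrite -[X in measurable X]setTI; apply: measurable_coarsen => //;
  exact: measurable_lower_set.
all: have mlim s : measurable [set v | lower_set s (limit_matrix j v)] by
  rewrite -[X in measurable X]setTI; apply: measurable_limit_matrix => //;
  exact: measurable_lower_set.
- change (uniform01 [set v | lower_set t (limit_matrix j v)] <=
    mu (K j) (lower_set (shift_mx t e)) + e%:E)%E.
  apply: (@le_trans _ _ (uniform01 [set v | lower_set t (approx m j (rword m.+1 v))])).
    apply: le_measure_ae; [exact: mlim|exact: mapprox|].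
    apply: filterS limit_matrix_approx => v h Xt a b.
    by have /andP[h1 _] := h j m jm a b; rewrite (le_trans h1)// Xt.
  rewrite [leLHS]approxE -coarsenE.
  apply: (@le_trans _ _ (mu (K m.+1) [set A | lower_set (shift_mx t e) (coarsen j A)])); last first.
    by rewrite leeDl// lee_fin ltW.
  apply: le_measure_ae => //.
  apply: filterS (Delta_ae mu_consistent (fact_pred m.+1)) => A DA At a b.
  have /andP[_ h2] := approx_hist jm (ltnSn m) DA a b.
  by rewrite shift_mxE; exact: (le_addr_trans h2 (At a b) me).
- rewrite -coarsenE.
  apply: (@le_trans _ _ (mu (K m.+1) [set A | lower_set t (approx m j (hist A))])).
    apply: le_measure_ae => //.
    apply: filterS (Delta_ae mu_consistent (fact_pred m.+1)) => A DA At a b.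
    have /andP[h1 _] := approx_hist jm (ltnSn m) DA a b.
    by rewrite subr_ge0 in h1; exact: le_trans h1 (At a b).
  rewrite -approxE.
  change (uniform01 [set v | lower_set t (approx m j (rword m.+1 v))] <=
    uniform01 [set v | lower_set (shift_mx t e) (limit_matrix j v)] + e%:E)%E.
  apply: (@le_trans _ _ (uniform01 [set v | lower_set (shift_mx t e) (limit_matrix j v)])).
    apply: le_measure_ae; [exact: mapprox|exact: mlim|].
    apply: filterS limit_matrix_approx => v h Xt a b.
    have /andP[_ h1] := h j m jm a b.
    by rewrite shift_mxE (le_trans h1)// lerD.
  by rewrite leeDl// lee_fin ltW.
Qed.

End RandomMatrices.

(** * Sampling a point from the random matrices *)
Section ProductUniform.
Set Implicit Arguments.
Unset Strict Implicit.
Variable R : realType.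

Definition square01 : set (R * R) -> \bar R := (@uniform01 R \x @uniform01 R)%E.

HB.instance Definition _ := Measure.copy square01 (@uniform01 R \x @uniform01 R)%E.

Let square01_setT : square01 setT = 1%E.
Proof.
rewrite /square01 -setXTT; transitivity (1 * 1 : \bar R)%E; last by rewrite mule1.
apply: (etrans (product_measure1E _ _ _ _)) => //.
by congr (_ * _)%E; exact: probability_setT.
Qed.

HB.instance Definition _ := Measure_isProbability.Build _ _ R square01 square01_setT.

Lemma square01E (A : set (R * R)) (f : R -> \bar R) :
  measurable A -> measurable_fun setT f ->
  {ae uniform01, forall u, uniform01 (xsection A u) = f u} ->
  square01 A = (\int[uniform01]_u f u)%E.
Proof.
move=> mA mf Af; apply: ae_eq_integral => //.
- exact: measurable_fun_xsection.
- by apply: filterS Af => u + _.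
Qed.

(** Tonelli: the measures of the sections of a null set integrate to zero, so almost all of them
    vanish. *)
Lemma ae_section (Q : R -> R -> Prop) : {ae square01, forall z, Q z.1 z.2} ->
  {ae uniform01, forall u, {ae uniform01, forall v, Q u v}}.
Proof.
move=> [N [mN N0 QN]].
have : ae_eq uniform01 setT (fun u => uniform01 (xsection N u)) (cst 0%E).
  apply/ae_eq_integral_abs => //; first exact: measurable_fun_xsection.
  rewrite -[RHS]N0; apply: eq_integral => u _.
  by rewrite gee0_abs.
apply: filterS => u /(_ I) /= Nu; exists (xsection N u); split => //.
  exact: measurable_xsection.
by move=> v /= nQ; rewrite /xsection/= inE; exact: QN.
Qed.

End ProductUniform.
Arguments square01 {R}.

(** * Sampling a point of the square from a consistent family of matrices *)

Section PointMap.
Set Implicit Arguments.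
Unset Strict Implicit.
Variables (R : realType) (mu : forall k : nat, probability (mxT R k) R).
Hypothesis mu_consistent : eq_consistent_model mu.
Local Notation K n := (fact_pred n).+1.
Variable X : forall n, R -> mxT R (K n).
Hypothesis measurable_X : forall n, measurable_fun setT (X n).
Hypothesis X_law : forall n (A : set (mxT R (K n))), measurable A ->
  uniform01 (X n @^-1` A) = mu (K n) A.
Hypothesis X_consistent : {ae uniform01, forall u, forall j l, (j <= l)%N ->
  coarsen j (X l u) = X j u}.

Let entry n u (e : 'I_(K n) * 'I_(K n)) : R := (X n u : 'M[R]_(K n)) e.1 e.2.

Definition cell n : finType := ('I_(K n) * 'I_(K n))%type.

Definition parent n (e : cell n.+1) : cell n :=
  (block (fact_pred n) e.1, block (fact_pred n) e.2).

(** The address of a cell lists its rank and those of its ancestors down to level [0], hence [n.+1]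
    letters. *)
Fixpoint path_of n : cell n -> seq nat :=
  if n is m.+1 then fun e : cell m.+1 => val (enum_rank e) :: path_of (parent e)
  else fun e => [:: val (enum_rank e)].

Lemma size_path_of n (e : cell n) : size (path_of e) = n.+1.
Proof. by elim: n e => //= n ih e; rewrite ih. Qed.

Lemma path_ofE n (e : cell n) : path_of e = val (enum_rank e) :: behead (path_of e).
Proof. by case: n e. Qed.

(** At most one cell has a given address, so the sum is the entry of that cell, or zero if the word
    is no address. *)
Definition path_weight (s : seq nat) (u : R) : R :=
  if s is _ :: s' then
    \sum_(e : cell (size s')) (if path_of e == s then entry u e else 0)
  else 1.

Lemma path_weightE n c s u : size s = n ->
  path_weight (c :: s) u = \sum_(e : cell n) (if path_of e == c :: s then entry u e else 0).
Proof. by move=> <-. Qed.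

Lemma measurable_path_weight s : measurable_fun setT (path_weight s).
Proof.
case: s => [|c s]; first exact: measurable_cst.
apply: measurable_sum => e; have [_|_] := boolP (path_of e == c :: s).
  move=> _ Y mY; rewrite setTI.
  have := measurable_coord e.1 e.2 measurableT mY; rewrite setTI => h.
  by have := measurable_X measurableT h; rewrite setTI.
exact: measurable_cst.
Qed.

Definition valid_sample u := (forall n, Delta R (K n) (X n u)) /\
  forall j l, (j <= l)%N -> coarsen j (X l u) = X j u.

Lemma valid_sample_ae : {ae uniform01, forall u, valid_sample u}.
Proof.
have D : {ae uniform01, forall u, forall n, Delta R (K n) (X n u)}.
  apply: ae_foralln => n.
  apply: (@ae_of_probability1 _ _ _ uniform01 (X n @^-1` Delta R (K n))).
    rewrite -[X in measurable X]setTI; apply: measurable_X => //.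
    exact: measurable_Delta.
  by rewrite [LHS]X_law ?mu_consistent.1//; exact: measurable_Delta.
by apply: filterS2 D X_consistent.
Qed.

Lemma sum_path_letter n s (F : cell n -> R) :
  \sum_(l < #|cell n|) \sum_(e : cell n) (if path_of e == val l :: s then F e else 0) =
  \sum_(e : cell n) (if behead (path_of e) == s then F e else 0).
Proof.
rewrite exchange_big/=; apply: eq_bigr => e _.
rewrite (bigD1 (enum_rank e))//= big1 ?addr0.
  by rewrite path_ofE eqseq_cons eqxx.
move=> l le; rewrite path_ofE eqseq_cons (inj_eq val_inj).
by rewrite eq_sym (negbTE le).
Qed.

(** Additivity is the identity [coarsen j (X l u) = X j u] between consecutive levels: the entry of
    a cell is the sum over its subcells. *)
Lemma path_weight_tree u : valid_sample u -> weight_tree (fun n => #|cell n|) path_weight u.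
Proof.
move=> [DX cX]; have X0 n (e : cell n) : 0 <= entry u e by exact: (DX n).1.
split => //.
- by move=> [|c s] //=; apply: sumr_ge0 => e _; case: ifP.
- move=> [|c s].
    under eq_bigr do rewrite (path_weightE _ _ (erefl : size [::] = 0%N)).
    rewrite sum_path_letter/=; have [_ <-] := DX 0%N.
    by rewrite pair_big.
  under eq_bigr do rewrite (path_weightE _ _ (erefl : size (c :: s) = (size s).+1)).
  rewrite sum_path_letter/= [RHS](partition_big (@parent (size s)) xpredT)//=.
  apply: eq_bigr => e _; rewrite -big_mkcondr.
  have [pe|pe] := boolP (path_of e == c :: s).
    rewrite /entry -(cX (size s) (size s).+1)// /coarsen rhoE pair_big/=.
    apply: eq_bigl => -[a b]; have [pE|pE] := eqVneq (parent (a, b)) e.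
      by rewrite pE pe -pE /parent/= !eqxx.
    apply/negbTE/negP => /andP[/eqP ae /eqP be]; case/eqP: pE.
    by rewrite /parent/= ae be -surjective_pairing.
  rewrite big1// => e' /andP[/eqP -> pe']; by rewrite pe' in pe.
- move=> s l sl; rewrite (path_weightE _ _ (erefl : size s = size s)) big1// => e _.
  case: ifPn => // /eqP; rewrite path_ofE => -[el _].
  by move: sl; rewrite -el leqNgt ltn_ord.
Qed.

Definition path_word n u v := word (fun n => #|cell n|) path_weight n u v.

(** Only the latest letter is read, with a default cell if it is out of range. That the other
    letters are the ancestors of this cell holds almost surely, by [path_word_ae]. *)
Definition cell_of n (s : seq nat) : cell n :=
  nth (ord0, ord0) (enum (cell n)) (head 0%N s).

Definition sample_cell n u v : cell n := cell_of n (path_word n.+1 u v).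

Lemma path_ofK n : cancel (@path_of n) (@cell_of n).
Proof. by move=> e; rewrite /cell_of path_ofE/= nth_enum_rank. Qed.

Lemma measurable_path_word n (W : set (seq nat)) :
  measurable [set z : R * R | W (path_word n z.1 z.2)].
Proof. by apply: measurable_word_set; exact: measurable_path_weight. Qed.

Lemma measurable_path_word_section n u (W : set (seq nat)) :
  measurable [set v | W (path_word n u v)].
Proof.
have := measurable_xsection u (measurable_path_word n W).
rewrite [X in measurable X -> _](_ : _ = [set v | W (path_word n u v)])//.
by apply/seteqP; split => v; rewrite /xsection/= inE.
Qed.

Lemma path_word_law n u (e : cell n) : valid_sample u ->
  uniform01 [set v | path_word n.+1 u v = path_of e] = (entry u e)%:E.
Proof.
move=> /path_weight_tree h; have := word_law h (path_of e).
rewrite size_path_of => ->; congr EFin.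
have sb : size (behead (path_of e)) = n by rewrite size_behead size_path_of.
rewrite [in LHS]path_ofE (path_weightE _ _ sb) -path_ofE (bigD1 e)//= eqxx.
rewrite big1 ?addr0// => e' ee'; rewrite (inj_eq (can_inj (@path_ofK n))).
by rewrite (negbTE ee').
Qed.

(** The addresses of the cells already have total probability [1], the sum of the entries of
    [X n u], so all other words are null. *)
Lemma path_word_ae u : valid_sample u ->
  {ae uniform01, forall v, forall n, path_word n.+1 u v = path_of (sample_cell n u v)}.
Proof.
move=> vu; apply: ae_foralln => n.
pose W := [set s | s = path_of (cell_of n s)].
have mW : measurable [set v | W (path_word n.+1 u v)].
  exact: measurable_path_word_section.
apply: (ae_of_probability1 (P := uniform01) mW).
rewrite (@measure_partition _ _ _ _ _ (sample_cell n u))//; last first.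
  by move=> e; exact: (measurable_path_word_section n.+1 u [set s | cell_of n s = e]).
rewrite (eq_bigr (fun e => (entry u e)%:E)).
  by rewrite sumEFin -[in RHS](vu.1 n).2 pair_big.
move=> e _; rewrite -path_word_law//; congr (uniform01 _).
apply/seteqP; split => v /=.
  by move=> [+ ve]; rewrite /W/= -/(sample_cell n u v) ve.
by move=> ve; rewrite /W /sample_cell /= ve path_ofK.
Qed.

Lemma sample_cell_law n u (e : cell n) : valid_sample u ->
  uniform01 [set v | sample_cell n u v = e] = (entry u e)%:E.
Proof.
move=> vu; rewrite -path_word_law//; apply: eq_measure_ae.
- exact: (measurable_path_word_section n.+1 u [set s | cell_of n s = e]).
- exact: (measurable_path_word_section n.+1 u [set s | s = path_of e]).
apply: filterS (path_word_ae vu) => v /(_ n) vn; split => ve.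
  by rewrite -(ve : sample_cell n u v = e); exact: vn.
by rewrite /= /sample_cell (ve : path_word n.+1 u v = path_of e) path_ofK.
Qed.

Lemma measurable_sample_cell n (E : set (cell n)) :
  measurable [set z : R * R | E (sample_cell n z.1 z.2)].
Proof. exact: (measurable_path_word n.+1 [set s | E (cell_of n s)]). Qed.

Lemma sample_cell_parent_ae : {ae square01, forall z, forall n,
  parent (sample_cell n.+1 z.1 z.2) = sample_cell n z.1 z.2}.
Proof.
apply: ae_foralln => n.
pose W := [set s : seq nat | parent (cell_of n.+1 s) = cell_of n (behead s)].
have mW : measurable [set z : R * R | W (path_word n.+2 z.1 z.2)].
  exact: measurable_path_word.
apply: (ae_of_probability1 (P := square01) mW).
transitivity (\int[uniform01]_(u in [set: R]) cst 1%E u)%E; last first.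
  by rewrite integral_cst// mul1e; exact: probability_setT.
apply: square01E => //.
apply: filterS valid_sample_ae => u vu.
apply/eqP; rewrite eq_le probability_le1/=; last exact: measurable_xsection.
rewrite -(@probability_setT _ _ _ (@uniform01 R)); apply: le_measure_ae => //.
  exact: measurable_xsection.
apply: filterS (path_word_ae vu) => v h _; rewrite /xsection/= inE /W/=.
have h1 := h n.+1; have h0 := h n.
rewrite -/(sample_cell n.+1 u v) -/(path_word n.+1 u v).
move: (h1); rewrite {1}/path_word/= => -[_]; rewrite -/(path_word n.+1 u v) => h2.
by rewrite -/(sample_cell n u v) -(path_ofK (parent _)) -h2.
Qed.

Definition coord (b : bool) n (e : cell n) : 'I_(K n) := if b then e.2 else e.1.

Lemma measurable_norm_sum b n (a : 'I_(K n)) :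
  measurable_fun setT (fun A : mxT R (K n) => \sum_(c < K n)
    `|if b then (A : 'M[R]_(K n)) c a else (A : 'M[R]_(K n)) a c|).
Proof.
apply: measurable_sum => c; apply: measurableT_comp => //.
by case: b; exact: measurable_coord.
Qed.

(** Given [u], the probability is a row or column sum of [X n u]; its mean is supplied by [mean_row]
    and [mean_col]. *)
Lemma coord_law b n (a : 'I_(K n)) :
  square01 [set z | coord b (sample_cell n z.1 z.2) = a] = ((K n)%:R^-1)%:E.
Proof.
pose f (A : mxT R (K n)) : \bar R := (\sum_(c < K n)
    `|if b then (A : 'M[R]_(K n)) c a else (A : 'M[R]_(K n)) a c|)%:E.
have mf : measurable_fun setT f by apply/measurable_EFinP; exact: measurable_norm_sum.
have f0 A : (0 <= f A)%E by rewrite lee_fin sumr_ge0.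
pose XX : {mfun R >-> mxT R (K n)} :=
  HB.pack (X n) (isMeasurableFun.Build _ _ _ _ _ (@measurable_X n)).
transitivity (\int[uniform01]_u (f \o X n) u)%E; last first.
  transitivity (\int[distribution uniform01 XX]_A f A)%E.
    by rewrite ge0_integral_distribution.
  transitivity (\int[mu (K n)]_A f A)%E.
    by apply: eq_measure_integral => /= A mA _; exact: X_law.
  by rewrite /f; case: (b); [exact: mean_col|exact: mean_row].
apply: square01E.
- exact: (measurable_sample_cell [set e : cell n | coord b e = a]).
- exact: measurableT_comp.
apply: filterS valid_sample_ae => u vu.
rewrite (_ : xsection _ u = [set v | coord b (sample_cell n u v) = a]); last first.
  by apply/seteqP; split => v; rewrite /xsection/= inE.
rewrite (@measure_partition _ _ _ _ _ (sample_cell n u)); last 2 first.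
  exact: (measurable_path_word_section n.+1 u [set s | coord b (cell_of n s) = a]).
  by move=> e; exact: (measurable_path_word_section n.+1 u [set s | cell_of n s = e]).
rewrite (eq_bigr (fun e : cell n => if coord b e == a then (entry u e)%:E else 0%E)); last first.
  move=> e _; case: ifPn => [/eqP ea|ea].
    rewrite -sample_cell_law//; congr (uniform01 _); apply/seteqP.
    by split => v /=; [case|move=> ve; rewrite ve].
  rewrite (_ : _ `&` _ = set0) ?measure0//.
  by apply/seteqP; split => // v /= [] + ve; rewrite ve => /eqP; rewrite (negbTE ea).
rewrite -big_mkcond/= sumEFin /f/=; congr EFin.
have X0 := (vu.1 n).1.
rewrite /coord; case: b {f mf f0}.
  under [RHS]eq_bigr do rewrite ger0_norm//.
  transitivity (\sum_(c < K n) \sum_(d < K n | d == a) entry u (c, d)).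
    by rewrite pair_big/=; apply: eq_bigr => -[].
  by apply: eq_bigr => c _; rewrite big_pred1_eq.
under [RHS]eq_bigr do rewrite ger0_norm//.
transitivity (\sum_(c < K n | c == a) \sum_(d < K n) entry u (c, d)).
  by rewrite pair_big/=; apply: eq_big => -[c d]//=; rewrite andbT.
by rewrite big_pred1_eq.
Qed.

(* For [b = false] the abscissa, for [b = true] the ordinate of the sampled point. *)
Definition sample_coord b u v : R :=
  sups (fun n => (coord b (sample_cell n u v))%:R / (K n)%:R) 0%N.

Lemma coord_ratio_bound b n u v :
  0 <= ((coord b (sample_cell n u v))%:R / (K n)%:R : R) <= 1.
Proof.
rewrite divr_ge0//= ler_pdivrMr ?ltr0n// mul1r ler_nat.
exact: ltnW.
Qed.

Lemma measurable_sample_coord b :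
  measurable_fun setT (fun z : R * R => sample_coord b z.1 z.2).
Proof.
apply: measurable_fun_sups => [z _|n].
  by exists 1 => _ [n _ <-]; case/andP: (coord_ratio_bound b n z.1 z.2).
move=> _ Y mY; rewrite setTI.
exact: (measurable_sample_cell [set e : cell n | Y ((coord b e)%:R / (K n)%:R)]).
Qed.

Lemma block_coord b n u v : parent (sample_cell n.+1 u v) = sample_cell n u v ->
  block (fact_pred n) (coord b (sample_cell n.+1 u v)) = coord b (sample_cell n u v).
Proof. by move=> <-; case: b. Qed.

(** The sampled cells are nested, so their left ends increase and none of them passes the right end
    of another. The supremum lies in every cell, possibly at its right end. *)
Lemma sample_coord_bounds : {ae square01, forall z, forall b n,
  (coord b (sample_cell n z.1 z.2))%:R / (K n)%:R <= sample_coord b z.1 z.2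
  <= (coord b (sample_cell n z.1 z.2)).+1%:R / (K n)%:R}.
Proof.
apply: filterS sample_cell_parent_ae => -[u v] /= h b.
set a := fun n => coord b (sample_cell n u v).
have aS n i : block (fact_pred n) (a (n + i)%N) = a n.
  elim: i => [|i ih].
    by apply/val_inj; rewrite /= blockE addn0// divnn/= divn1.
  rewrite addnS -ih -[a (n + i)%N](block_coord b (h (n + i)%N)) block_comp//.
    by rewrite dvdn_fact_pred// leq_addr.
  by rewrite dvdn_fact_pred.
have K0 n : 0 < (K n)%:R :> R by rewrite ltr0n.
have bounds n i : (a n)%:R / (K n)%:R <= (a (n + i)%N)%:R / (K (n + i))%:R :> R /\
    (a (n + i)%N)%:R / (K (n + i))%:R <= (a n).+1%:R / (K n)%:R :> R.
  have d : (K n %| K (n + i))%N by rewrite dvdn_fact_pred// leq_addr.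
  have /eqP := aS n i; rewrite block_itv// => /andP[h1 h2].
  rewrite !ler_pdivlMr// !(mulrAC _ (_^-1)) !ler_pdivrMr// -!natrM !ler_nat.
  have [h3 h4] := block_bounds (divnK d) h1 h2.
  by split => //; rewrite (leq_trans _ h4)// leq_mul2r leqnSn orbT.
have bnd m n : (a m)%:R / (K m)%:R <= (a n).+1%:R / (K n)%:R :> R.
  have [nm|mn] := leqP n m; first by rewrite -(subnKC nm); exact: (bounds _ _).2.
  rewrite (le_trans (bounds m (n - m)%N).1)// subnKC ?(ltnW mn)//.
  by rewrite ler_pM2r ?invr_gt0// ler_nat.
move=> n; apply/andP; split.
  apply: ub_le_sup; last by exists n.
  by exists 1 => _ [m _ <-]; case/andP: (coord_ratio_bound b m u v).
by apply: ge_sup; [exists ((a 0%N)%:R / (K 0)%:R), 0%N|move=> _ [m _ <-]; exact: bnd].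
Qed.

Lemma measurable_sample_coord_set b (Y : set R) : measurable Y ->
  measurable [set z : R * R | Y (sample_coord b z.1 z.2)].
Proof. by move=> mY; have := measurable_sample_coord b measurableT mY; rewrite setTI. Qed.

Lemma coord_law_eq b n (m : nat) :
  (square01 [set z | coord b (sample_cell n z.1 z.2) = m :> nat] <= ((K n)%:R^-1)%:E)%E.
Proof.
have [mK|Km] := ltnP m (K n).
  rewrite -(coord_law b (Ordinal mK)); apply: le_measure; rewrite ?inE.
  - exact: (measurable_sample_cell [set e : cell n | coord b e = m :> nat]).
  - exact: (measurable_sample_cell [set e : cell n | coord b e = Ordinal mK]).
  - by move=> z /= zm; exact/val_inj.
rewrite (_ : [set z | _] = set0) ?measure0 ?lee_fin ?invr_ge0//.
by apply/seteqP; split => // z /= zm; move: Km; rewrite -zm leqNgt ltn_ord.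
Qed.

(* A point with given coordinate lies in one of two neighbouring columns of each grid. *)
Lemma sample_coord_atomless b (q : R) :
  square01 [set z | sample_coord b z.1 z.2 = q] = 0%E.
Proof.
apply/eqP; rewrite eq_le measure_ge0 andbT; apply/lee_addgt0Pr => e e0; rewrite add0e.
have [n ne] := le_natV_eps (divr_gt0 e0 (@ltr0n R 2)).
pose A i := [set z : R * R | coord b (sample_cell n.+1 z.1 z.2) = i :> nat].
have mA i : measurable (A i).
  exact: (measurable_sample_cell [set e : cell n.+1 | coord b e = i :> nat]).
(* From [a <= q * K <= a + 1] the column [a] is [t] or, when [q * K] is its right end, [t - 1]. *)
pose t := Num.truncn (q * (K n.+1)%:R).
have K0 : 0 < (K n.+1)%:R :> R by rewrite ltr0n.
have Ke : (K n.+1)%:R^-1 <= e / 2.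
  rewrite (le_trans _ ne)// lef_pV2 ?posrE// ler_nat fact_predK.
  by rewrite factS leq_pmulr// fact_gt0.
apply: (@le_trans _ _ (square01 (A t `|` A t.-1))).
  apply: le_measure_ae; [exact: (measurable_sample_coord_set b (measurable_set1 q))|
    exact: measurableU|].
  apply: filterS sample_coord_bounds => z /(_ b n.+1) + zq; rewrite zq.
  set a := coord b _; rewrite ler_pdivrMr// ler_pdivlMr// => /andP[h1 h2].
  have q0 : 0 <= q * (K n.+1)%:R by rewrite (le_trans _ h1).
  have /andP[t1 t2] := truncn_itv q0; rewrite -/t in t1 t2.
  have at1 : (a <= t)%N by rewrite -ltnS -(ltr_nat R) (le_lt_trans h1).
  have ta : (t <= a.+1)%N by rewrite -(ler_nat R) (le_trans t1).
  rewrite /A/= -/a; move: at1; rewrite leq_eqVlt => /predU1P[->|at1]; first by left.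
  by right; apply/eqP; lia.
rewrite (le_trans (measureU2 _ _ _))// (le_trans (leeD (coord_law_eq _ _ _) (coord_law_eq _ _ _)))//.
by rewrite -EFinD lee_fin (splitr e) lerD.
Qed.

(** The previous bounds only give closed cells. Atomlessness discards the countably many grid
    values, after which the inequality on the right is strict and the half-open cell is
    determined. *)
Lemma coord_sample_coord : {ae square01, forall z, forall b n (a : 'I_(K n)),
  @Ik R _ a (sample_coord b z.1 z.2) <-> coord b (sample_cell n z.1 z.2) = a}.
Proof.
have nq : {ae square01, forall z, forall m n, forall b, sample_coord b z.1 z.2 <> m%:R / (K n)%:R}.
  apply: ae_foralln => m; apply: ae_foralln => n.
  have nqb b : {ae square01, forall z, sample_coord b z.1 z.2 <> m%:R / (K n)%:R}.
    exists [set z | sample_coord b z.1 z.2 = m%:R / (K n)%:R]; split.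
    - exact: (measurable_sample_coord_set b (measurable_set1 _)).
    - exact: sample_coord_atomless.
    - by move=> z /= /contrapT.
  by apply: filterS2 (nqb true) (nqb false) => z ht hf [].
apply: filterS2 nq sample_coord_bounds => z nq h b n a.
have /andP[] := h b n; set c := coord b _; set x := sample_coord b z.1 z.2.
have K0 : 0 < (K n)%:R :> R by rewrite ltr0n.
rewrite le_eqVlt => /predU1P[/esym/nq//|cx] xc.
rewrite /Ik/= in_itv/=; split=> [/andP[ax xa]|<-].
  apply/val_inj/eqP; rewrite eqn_leq; apply/andP; split; rewrite -ltnS -(ltr_nat R).
    by have := lt_trans cx xa; rewrite ltr_pM2r ?invr_gt0.
  have := le_lt_trans ax (_ : x < c.+1%:R / (K n)%:R).
  rewrite ltr_pM2r ?invr_gt0//; apply; rewrite lt_neqAle xc andbT.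
  exact/eqP/nq.
by rewrite (ltW cx)/= lt_neqAle xc andbT; exact/eqP/nq.
Qed.

End PointMap.

(** * A random measure is determined by its grid matrices *)
Section GridMeasures.
Set Implicit Arguments.
Unset Strict Implicit.
Variable R : realType.
Local Notation K n := (fact_pred n).+1.
Local Notation I01' := (`[0 : R, 1[%classic).

Lemma measure_finU d (T : measurableType d) (P : {measure set T -> \bar R})
    (J : finType) (p : pred J) (F : J -> set T) :
  (forall i, measurable (F i)) -> trivIset setT F ->
  P (\bigcup_(i in [set i | p i]) F i) = (\sum_(i | p i) P (F i))%E.
Proof.
move=> mF tF; rewrite big_mkcond/=.
transitivity (\sum_(i \in [set: J]) (if p i then P (F i) else 0))%E; last first.
  have -> : [set: J] = [set` index_enum J].
    by apply/seteqP; split => // i _ /=; exact: mem_index_enum.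
  by rewrite -fsbig_seq// index_enum_uniq.
rewrite (eq_fsbigr (fun i => P (if p i then F i else set0))); last first.
  by move=> i _; case: ifP => //; rewrite measure0.
rewrite -measure_fin_bigcup//=.
- congr (P _); apply/seteqP; split => [x [i /= pi Fx]|x [i _]].
    by exists i => //; rewrite pi.
  by case: ifP => // pi Fx; exists i.
- move=> i j _ _ [x []]; case: ifP => // _ Fi; case: ifP => // _ Fj.
  by apply: (tF i j I I); exists x.
- by move=> i _; case: ifP.
Qed.

Lemma measurable_Ik k (i : 'I_k) : measurable (Ik i : set R).
Proof. exact: measurable_itv. Qed.

Lemma Ik_inj k (i j : 'I_k) (x : R) : Ik i x -> Ik j x -> i = j.
Proof.
have k0 : 0 < k%:R :> R by rewrite ltr0n (leq_ltn_trans _ (ltn_ord i)).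
rewrite /Ik/= !in_itv/= => /andP[ix xi] /andP[jx xj].
apply/val_inj/eqP; rewrite eqn_leq; apply/andP; split; rewrite -ltnS -(ltr_nat R).
  by have := le_lt_trans ix xj; rewrite ltr_pM2r ?invr_gt0.
by have := le_lt_trans jx xi; rewrite ltr_pM2r ?invr_gt0.
Qed.

Lemma trivIset_Ik k : trivIset setT (@Ik R k).
Proof. by move=> i j _ _ [x [ix jx]]; exact: Ik_inj jx. Qed.

Lemma Ik_cover k (x : R) : (0 < k)%N -> 0 <= x < 1 -> exists i : 'I_k, Ik i x.
Proof.
move=> k0 /andP[x0 x1]; have k0' : 0 < k%:R :> R by rewrite ltr0n.
have xk0 : 0 <= x * k%:R by rewrite mulr_ge0// ltW.
have /andP[t1 t2] := truncn_itv xk0.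
have tk : (Num.truncn (x * k%:R) < k)%N.
  by rewrite -(ltr_nat R) (le_lt_trans t1)// gtr_pMl.
by exists (Ordinal tk); rewrite /Ik/= in_itv/= ler_pdivrMr// ltr_pdivlMr// t1.
Qed.

Lemma Ik_unit k (i : 'I_k) (x : R) : Ik i x -> 0 <= x < 1.
Proof.
have k0 : 0 < k%:R :> R by rewrite ltr0n (leq_ltn_trans _ (ltn_ord i)).
rewrite /Ik/= in_itv/= => /andP[ix xi]; rewrite (le_trans _ ix) ?divr_ge0//=.
by rewrite (lt_le_trans xi)// ler_pdivrMr// mul1r ler_nat.
Qed.

Definition fiber_union N k (f : 'I_N -> 'I_k) (i : 'I_k) : set R :=
  \bigcup_(v in [set v | f v == i]) Ik v.

Lemma measurable_fiber_union N k (f : 'I_N -> 'I_k) i : measurable (fiber_union f i).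
Proof.
by apply: fin_bigcup_measurable => // v _; exact: measurable_Ik.
Qed.

Lemma Ik_block m k (v : 'I_m.+1) (x : R) : (k.+1 %| m.+1)%N -> Ik v x ->
  Ik (block k v) x.
Proof.
move=> km; have := eqxx (block k v); rewrite block_itv// => /andP[av va].
have [h1 h2] := block_bounds (divnK km) av va.
rewrite /Ik/= !in_itv/= => /andP[vx xv]; apply/andP; split.
  apply: le_trans vx; rewrite ler_pdivrMr ?ltr0n// mulrAC ler_pdivlMr ?ltr0n//.
  by rewrite -!natrM ler_nat.
apply: (lt_le_trans xv); rewrite ler_pdivrMr ?ltr0n// mulrAC ler_pdivlMr ?ltr0n//.
by rewrite -!natrM ler_nat.
Qed.

Lemma fiber_union_block m k (a : 'I_k.+1) : (k.+1 %| m.+1)%N ->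
  fiber_union (@block m k) a = Ik a.
Proof.
move=> km; apply/seteqP; split => [x [v /= /eqP <- vx]|x ax]; first exact: Ik_block.
have [v vx] := Ik_cover (ltn0Sn m) (Ik_unit ax).
by exists v => //=; apply/eqP/esym/(Ik_inj ax)/Ik_block.
Qed.

Lemma measure_fiber_union N k (f : 'I_N -> 'I_k) (m : {measure set (R * R) -> \bar R}) i j :
  m (fiber_union f i `*` fiber_union f j) =
  (\sum_(v | f v == i) \sum_(u | f u == j) m (Ik v `*` Ik u))%E.
Proof.
rewrite pair_big/= -(measure_finU _ (fun p => (f p.1 == i) && (f p.2 == j))
  (F := fun p : 'I_N * 'I_N => Ik p.1 `*` Ik p.2)).
- congr (m _); apply/seteqP; split => [[x y] [[v /= vi vx] [u /= uj uy]]|].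
    by exists (v, u) => //=; rewrite vi.
  move=> [x y] [[v u] /= /andP[vi uj] [vx uy]].
  by split; [exists v|exists u].
- by move=> p; apply: measurableX; exact: measurable_Ik.
- move=> [v u] [v' u'] _ _ [[x y] [[/= h1 h2] [/= h3 h4]]].
  by rewrite (Ik_inj h1 h3) (Ik_inj h2 h4).
Qed.

Lemma GkE k (m : PM R) i j : (Gk R k m : 'M[R]_k) i j = fine (m (Ik i `*` Ik j)).
Proof. by rewrite /Gk mxE. Qed.

(** This reads relabelling geometrically, so that consistency under an equipartition becomes a
    statement about masses of unions of cells. *)
Lemma rho_Gk N k (f : 'I_N -> 'I_k) (m : PM R) i j :
  (rho f (Gk R N m) : 'M[R]_k) i j = fine (m (fiber_union f i `*` fiber_union f j)).
Proof.
rewrite rhoE; apply: EFin_inj; rewrite fineK; last first.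
  by apply: fin_num_measure; apply: measurableX; exact: measurable_fiber_union.
rewrite [RHS](measure_fiber_union f m).
rewrite -sumEFin; apply: eq_bigr => v _; rewrite -sumEFin; apply: eq_bigr => u _.
rewrite GkE fineK//; apply: fin_num_measure.
by apply: measurableX; exact: measurable_Ik.
Qed.

Lemma rho_block_Gk m k (M : PM R) : (k.+1 %| m.+1)%N ->
  rho (@block m k) (Gk R m.+1 M) = Gk R k.+1 M.
Proof.
by move=> km; apply/matrixP => i j; rewrite rho_Gk !fiber_union_block// GkE.
Qed.

Lemma measurable_ev (A : set (R * R)) : measurable A ->
  measurable_fun setT (fun m : PM R => m A).
Proof.
move=> mA; apply: (measurability _ (measurable_realfun.ErealGenInftyO.measurableE R)) => //.
move=> _ [_ [r ->] <-]; rewrite setTI preimage_itvNyo.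
have [r0|r0] := leP 0 r; last first.
  rewrite [X in measurable X](_ : _ = set0)//; exact: (lt0_mset A r0).
have [r1|r1] := leP r 1; last first.
  rewrite [X in measurable X](_ : _ = setT)//; exact: (gt1_mset mA r1).
apply: sub_sigma_algebra; exists r; first by rewrite /= in_itv/= r0.
by exists A.
Qed.

Lemma measurable_Gk k : measurable_fun setT (Gk R k).
Proof.
apply: measurable_mxT => i j; under eq_fun do rewrite GkE.
apply: measurableT_comp => //; apply: measurable_ev.
by apply: measurableX; exact: measurable_Ik.
Qed.

(** Only cells entirely to the left of [s] are taken. As the grids are nested, these sets increase,
    and they exhaust the ray within the half-open unit interval. *)
Definition grid_below n (s : R) : set R :=
  \bigcup_(a in [set a : 'I_(K n) | a.+1%:R / (K n)%:R <= s]) Ik a.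

Lemma measurable_grid_below n s : measurable (grid_below n s).
Proof.
by apply: fin_bigcup_measurable => // v _; exact: measurable_Ik.
Qed.

Lemma grid_below_nd s : nondecreasing_seq (grid_below ^~ s).
Proof.
move=> n m nm; apply/subsetPset => x [a /= as_ ax].
have [b bx] := Ik_cover (ltn0Sn (fact_pred m)) (Ik_unit ax).
exists b => //=; apply: le_trans as_.
have d := dvdn_fact_pred nm.
have /(Ik_inj ax)/esym/eqP := Ik_block d bx.
rewrite block_itv// => /andP[ab ba].
rewrite ler_pdivrMr ?ltr0n// mulrAC ler_pdivlMr ?ltr0n// -!natrM ler_nat.
exact: (block_bounds (divnK d) ab ba).2.
Qed.

Lemma grid_below_bigcup s : \bigcup_n grid_below n s = `]-oo, s[%classic `&` I01'.
Proof.
apply/seteqP; split => [x [n _ [a /= as_ ax]]|x []].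
  rewrite /= !in_itv/= (Ik_unit ax); split => //.
  by move: ax; rewrite /Ik/= in_itv/= => /andP[_ /lt_le_trans]; exact.
rewrite /= !in_itv/= => xs x01.
have sx0 : 0 < s - x by rewrite subr_gt0.
have [n ne] := le_natV_eps sx0.
have [a ax] := Ik_cover (ltn0Sn (fact_pred n.+1)) x01.
exists n.+1 => //; exists a => //=.
move: ax; rewrite /Ik/= in_itv/= => /andP[ax _].
have Kn : (K n.+1)%:R^-1 <= n.+1%:R^-1 :> R.
  by rewrite lef_pV2 ?posrE// ler_nat fact_predK factS leq_pmulr// fact_gt0.
by rewrite -natr1 mulrDl mul1r (le_trans (lerD ax (le_trans Kn ne)))// addrC subrK.
Qed.

Lemma ray_generates :
  @measurable _ R = <<s range (fun s : R => `]-oo, s[%classic) >>.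
Proof.
rewrite [LHS](measurable_realfun.RGenInftyO.measurableE R); congr <<s _ >>.
by apply/seteqP; split => A [x]; [move=> ->; exists x|move=> _ <-; exists x].
Qed.

Lemma rays_setI : setI_closed (range (fun s : R => `]-oo, s[%classic)).
Proof.
move=> _ _ [s _ <-] [t _ <-]; exists (Num.min s t) => //.
by apply/seteqP; split => [x|x []]; rewrite /= !in_itv/= lt_min; [move/andP|move=> -> ->].
Qed.

Lemma grid_probability_unique (P1 P2 : probability R R) :
  (forall n (a : 'I_(K n)), P1 (Ik a) = P2 (Ik a)) ->
  P1 I01' = 1%E -> P2 I01' = 1%E ->
  forall A, measurable A -> P1 A = P2 A.
Proof.
move=> P12 P1u P2u; apply: (probability_ext ray_generates rays_setI).
move=> _ [s _ <-].
have lim (P : probability R R) : P I01' = 1%E ->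
    P (grid_below n s) @[n --> \oo] --> P `]-oo, s[%classic.
  move=> Pu; have -> : P `]-oo, s[%classic = P (\bigcup_n grid_below n s).
    rewrite grid_below_bigcup; apply: eq_measure_ae => //.
      by apply: measurableI; exact: measurable_itv.
    apply: filterS (ae_of_probability1 _ Pu); last exact: measurable_itv.
    by move=> x ux; split => [|[]//]; split.
  apply: nondecreasing_cvg_mu.
  - by move=> n; exact: measurable_grid_below.
  - by apply: bigcupT_measurable => n; exact: measurable_grid_below.
  - exact: grid_below_nd.
have E n : P1 (grid_below n s) = P2 (grid_below n s).
  rewrite !(measure_finU _ (fun a : 'I_(K n) => a.+1%:R / (K n)%:R <= s)) //.
  - by apply: eq_bigr => a _; exact: P12.
  - by move=> a; exact: measurable_Ik.
  - exact: trivIset_Ik.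
  - by move=> a; exact: measurable_Ik.
  - exact: trivIset_Ik.
have := lim _ P1u; rewrite (eq_fun E) => l1.
exact: (cvg_unique _ l1 (lim _ P2u)).
Qed.

End GridMeasures.

Section Uniqueness.
Set Implicit Arguments.
Unset Strict Implicit.
Variable R : realType.
Local Notation K n := (fact_pred n).+1.
Local Notation I01' := (`[0 : R, 1[%classic).
Local Notation U2 := (I01' `*` I01').

(** Laws with the same grid matrices agree on the sigma-algebra generated by these sets. Uniqueness
    then amounts to recovering the evaluations from it. *)
Definition grid_cylinders : set (set (PM R)) :=
  [set S | exists n (A : set (mxT R (K n))), measurable A /\ S = Gk R (K n) @^-1` A].

Local Notation PMc := (g_sigma_algebraType grid_cylinders).

Lemma grid_cylinders_setI : setI_closed grid_cylinders.
Proof.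
move=> _ _ [n [A [mA ->]]] [m [B [mB ->]]].
exists (maxn n m), ((@coarsen R (maxn n m) n @^-1` A) `&` (@coarsen R (maxn n m) m @^-1` B)).
split.
  by apply: measurableI; rewrite -[X in measurable X]setTI; apply: measurable_coarsen.
have E j : (j <= maxn n m)%N -> forall M : PM R, coarsen j (Gk R (K (maxn n m)) M) = Gk R (K j) M.
  by move=> jn M; apply: rho_block_Gk; exact: dvdn_fact_pred.
by apply/seteqP; split => M /=; rewrite /= !E ?leq_maxl ?leq_maxr.
Qed.

Lemma measurable_Gk_cylinder n : measurable_fun setT (Gk R (K n) : PMc -> mxT R (K n)).
Proof.
move=> _ A mA; rewrite setTI; apply: sub_sigma_algebra.
by exists n, A.
Qed.

Lemma measurable_cell_cylinder n (a b : 'I_(K n)) :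
  measurable_fun setT (fun m : PMc => (m : PM R) (Ik a `*` Ik b)).
Proof.
rewrite (_ : (fun m : PMc => _) = (fun m : PMc => ((Gk R (K n) m : 'M[R]_(K n)) a b)%:E)).
  apply/measurable_EFinP.
  exact: (measurableT_comp (measurable_coord a b) (measurable_Gk_cylinder (n := n))).
apply/funext => m; rewrite GkE fineK//; apply: fin_num_measure.
by apply: measurableX; exact: measurable_Ik.
Qed.

(** One Dynkin argument for three uses: with [phi] equal to [snd], [fst] and [id], it frees the
    second side of a rectangle, then the first, then passes to all measurable sets. *)
Lemma measurable_ev_dynkin d (T : measurableType d) (G : set (set T))
    (phi : R * R -> T) (D : set (R * R)) :
  @measurable d T = <<s G >> -> setI_closed G ->
  measurable_fun setT phi -> measurable D ->
  measurable_fun setT (fun m : PMc => (m : PM R) D) ->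
  (forall A, G A -> measurable_fun setT (fun m : PMc => (m : PM R) (D `&` phi @^-1` A))) ->
  forall A, measurable A ->
    measurable_fun setT (fun m : PMc => (m : PM R) (D `&` phi @^-1` A)).
Proof.
move=> GE GI mphi mD mevD mG; rewrite [X in forall A, X A -> _]GE.
have mpre S : measurable S -> measurable (D `&` phi @^-1` S).
  by move=> mS; apply: measurableI => //; rewrite -[X in measurable X]setTI; exact: mphi.
apply: (@dynkin_induction _ _ G
  (fun A => measurable_fun setT (fun m : PMc => (m : PM R) (D `&` phi @^-1` A)))) => //.
- by under eq_fun do rewrite preimage_setT setIT.
- move=> S mS mevS.
  rewrite (_ : (fun m : PMc => _) =
    (fun m : PMc => (m : PM R) D - (m : PM R) (D `&` phi @^-1` S)))%E.
    exact: emeasurable_funB.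
  apply/funext => m; rewrite preimage_setC -setDE; apply: measureD => //.
    by rewrite -[X in measurable X]setTI; exact: mphi.
  by apply: (le_lt_trans (probability_le1 _ mD)); rewrite ltry.
- move=> F mF tF mevF.
  rewrite (_ : (fun m : PMc => _) =
    (fun m : PMc => \sum_(0 <= i <oo) (m : PM R) (D `&` phi @^-1` F i)))%E.
    by apply: ge0_emeasurable_sum.
  apply/funext => m; rewrite preimage_bigcup setI_bigcupr measure_bigcup//.
  + by apply: eq_eseriesl => i; apply/idP; exact: mem_set.
  + by move=> i _; exact: mpre.
  + move=> i j _ _ [x [[_ xi] [_ xj]]]; apply: (tF i j) => //.
    by exists (phi x).
Qed.

Lemma measurable_rays_cylinder s t : measurable_fun setT (fun m : PMc =>
  (m : PM R) ((`]-oo, s[ `&` I01') `*` (`]-oo, t[ `&` I01'))).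
Proof.
apply: (emeasurable_fun_cvg (fun n (m : PMc) => (m : PM R) (grid_below n s `*` grid_below n t))).
  move=> n; pose q (p : 'I_(K n) * 'I_(K n)) :=
    (p.1.+1%:R / (K n)%:R <= s) && (p.2.+1%:R / (K n)%:R <= t).
  rewrite (_ : (fun m : PMc => _) = (fun m : PMc =>
    \sum_(p : 'I_(K n) * 'I_(K n)) if q p then (m : PM R) (Ik p.1 `*` Ik p.2) else 0)%E).
    apply: emeasurable_sum => p; have [_|_] := boolP (q p).
      exact: measurable_cell_cylinder.
    exact: measurable_cst.
  apply/funext => m; rewrite -big_mkcond -(measure_finU _ q
      (F := fun p => Ik p.1 `*` Ik p.2)).
  - congr ((m : PM R) _); apply/seteqP; split => [[x y] [[a /= sa ax] [b /= tb bx]]|].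
      by exists (a, b) => //=; rewrite /q/= sa.
    by move=> [x y] [[a b] /= /andP[sa tb] [ax bx]]; split; [exists a|exists b].
  - by move=> p; apply: measurableX; exact: measurable_Ik.
  - move=> [v u] [v' u'] _ _ [[x y] [[/= h1 h2] [/= h3 h4]]].
    by rewrite (Ik_inj h1 h3) (Ik_inj h2 h4).
move=> m _; rewrite -!grid_below_bigcup.
rewrite (_ : _ `*` _ = \bigcup_n (grid_below n s `*` grid_below n t)); last first.
  apply/seteqP; split => [[x y] [[i _ /= xi] [j _ /= yj]]|[x y] [n _ [/= xn yn]]].
    exists (maxn i j) => //; split => /=.
      by move: xi; apply/subsetPset/grid_below_nd/leq_maxl.
    by move: yj; apply/subsetPset/grid_below_nd/leq_maxr.
  by split; exists n.
apply: nondecreasing_cvg_mu.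
- by move=> n; apply: measurableX; exact: measurable_grid_below.
- by apply: bigcupT_measurable => n; apply: measurableX; exact: measurable_grid_below.
- move=> i j ij; apply/subsetPset => -[x y] [/= xi yj]; split => /=.
    by move: xi; apply/subsetPset/grid_below_nd.
  by move: yj; apply/subsetPset/grid_below_nd.
Qed.

Lemma measurable_ev_cylinder (A : set (R * R)) : measurable A ->
  measurable_fun setT (fun m : PMc => (m : PM R) (U2 `&` A)).
Proof.
have mI : measurable (I01' : set R) by exact: measurable_itv.
have I1 : I01' = `]-oo, 1[%classic `&` I01'.
  by apply/esym/setIidr => x/=; rewrite !in_itv/= => /andP[].
have mr (s : R) : measurable (`]-oo, s[%classic : set R) by exact: measurable_itv.
have step1 s B : measurable B -> measurable_fun setT (fun m : PMc =>
    (m : PM R) (((`]-oo, s[ `&` I01') `*` I01') `&` snd @^-1` B)).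
  move: B; apply: (@measurable_ev_dynkin _ R _ snd ((`]-oo, s[ `&` I01') `*` I01')
    (ray_generates R) (@rays_setI R)) => //.
  - by apply: measurableX => //; exact: measurableI.
  - by rewrite {2}I1; exact: measurable_rays_cylinder.
  move=> _ [t _ <-]; rewrite [X in measurable_fun _ X](_ : _ = (fun m : PMc =>
    (m : PM R) ((`]-oo, s[ `&` I01') `*` (`]-oo, t[ `&` I01')))).
    exact: measurable_rays_cylinder.
  apply/funext => m; congr ((m : PM R) _).
  by apply/seteqP; split => -[x y] /=; [move=> [[? ?] ?]|move=> [? [? ?]]].
have step2 B C : measurable B -> measurable C -> measurable_fun setT (fun m : PMc =>
    (m : PM R) ((I01' `*` (I01' `&` B)) `&` fst @^-1` C)).
  move=> mB; move: C; apply: (@measurable_ev_dynkin _ R _ fst (I01' `*` (I01' `&` B))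
    (ray_generates R) (@rays_setI R)) => //.
  - by apply: measurableX => //; exact: measurableI.
  - rewrite [X in measurable_fun _ X](_ : _ = (fun m : PMc =>
      (m : PM R) (((`]-oo, 1[ `&` I01') `*` I01') `&` snd @^-1` B))); first exact: step1.
    apply/funext => m; congr ((m : PM R) _); rewrite -I1.
    by apply/seteqP; split => -[x y] /=; [move=> [? [? ?]]|move=> [[? ?] ?]].
  move=> _ [s _ <-]; rewrite [X in measurable_fun _ X](_ : _ = (fun m : PMc =>
      (m : PM R) (((`]-oo, s[ `&` I01') `*` I01') `&` snd @^-1` B))); first exact: step1.
  apply/funext => m; congr ((m : PM R) _).
  by apply/seteqP; split => -[x y] /=; [move=> [[? [? ?]] ?]|move=> [[[? ?] ?] ?]].
(* Measurable rectangles are covered by [step2]; they form a pi-system generating the product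
   sigma-algebra. *)
move: A; apply: (@measurable_ev_dynkin _ (R * R)%type
  [set C `*` B | C in measurable & B in measurable] id U2) => //.
- by rewrite measurable_prod_measurableType.
- move=> _ _ [A1 mA1 [A2 mA2 <-]] [B1 mB1 [B2 mB2 <-]].
  exists (A1 `&` B1); first exact: measurableI.
  by exists (A2 `&` B2); [exact: measurableI|rewrite setXI].
- exact: measurableX.
- rewrite {1}I1 {2}I1; exact: measurable_rays_cylinder.
move=> _ [C mC [B mB <-]]; rewrite [X in measurable_fun _ X](_ : _ = (fun m : PMc =>
    (m : PM R) ((I01' `*` (I01' `&` B)) `&` fst @^-1` C))); first exact: step2.
apply/funext => m; congr ((m : PM R) _).
by apply/seteqP; split => -[x y] /=; [move=> [[? ?] [? ?]]|move=> [[? [? ?]] ?]].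
Qed.

Definition carried : set (PM R) := [set m : PM R | m U2 = 1%E].

Lemma measurable_U2 : measurable (U2 : set (R * R)).
Proof. by apply: measurableX; exact: measurable_itv. Qed.

Lemma measurable_carried_cylinder : measurable (carried : set PMc).
Proof.
have := measurable_ev_cylinder measurableT measurableT (emeasurable_set1 1%E).
rewrite setTI; rewrite [X in measurable X -> _](_ : _ = carried)//.
by apply/seteqP; split => m; rewrite /carried/= setIT.
Qed.

(* Evaluations are measurable for [PMc] only after restriction to the unit square;
   this retraction carries measurability over to all evaluations. *)
Definition carried_part (m : PMc) : PM R :=
  if m \in (carried : set PMc) then m else point.

Lemma carried_ev (m : PM R) (A : set (R * R)) : measurable A -> carried m ->
  m A = m (U2 `&` A).
Proof.
move=> mA cm; apply: eq_measure_ae => //; first exact: measurableI measurable_U2 mA.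
apply: filterS (ae_of_probability1 measurable_U2 cm) => x ux.
by split => [|[]//].
Qed.

Lemma measurable_carried_part : measurable_fun setT carried_part.
Proof.
apply: (@measurability _ _ PMc (PM R) setT _ (@pset _ (R * R)%type R) erefl).
move=> _ [_ [r _ [A mA <-]] <-]; rewrite setTI.
rewrite [X in measurable X](_ : _ =
  (carried `&` ((fun m : PMc => (m : PM R) (U2 `&` A)) @^-1` `]-oo, r%:E[%classic)) `|`
  (~` carried `&` [set m | (point : PM R) A < r%:E]%E)).
  apply: measurableU; apply: measurableI.
  - exact: measurable_carried_cylinder.
  - rewrite -[X in measurable X]setTI; apply: measurable_ev_cylinder => //.
    exact: emeasurable_itv.
  - by apply: measurableC; exact: measurable_carried_cylinder.
  - have [pr|pr] := boolP ((point : PM R) A < r%:E)%E.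
      by rewrite [X in measurable X](_ : _ = setT)//; apply/seteqP.
    by rewrite [X in measurable X](_ : _ = set0)//; apply/seteqP; split => // m /=; rewrite (negbTE pr).
apply/seteqP; split => m; rewrite /carried_part /mset /preimage /=.
  case: ifPn => [/set_mem cm mr|/negP cm pr].
    by left; split => //; rewrite in_itv/= -carried_ev.
  by right; split => // /mem_set.
move=> [[cm]|[cm pr]].
  by rewrite in_itv/= -carried_ev// mem_set.
by rewrite memNset.
Qed.

Lemma random_measure_unique (Q1 Q2 : probability (PM R) R) :
  (forall n (A : set (mxT R (K n))), measurable A ->
    Q1 (Gk R (K n) @^-1` A) = Q2 (Gk R (K n) @^-1` A)) ->
  Q1 carried = 1%E -> Q2 carried = 1%E ->
  forall B, measurable B -> Q1 B = Q2 B.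
Proof.
move=> Q12 Q1c Q2c.
pose idc : PM R -> PMc := id.
have midc : measurable_fun setT idc.
  apply: (@measurability _ _ (PM R) PMc setT _ grid_cylinders erefl).
  move=> _ [_ [n [A [mA ->]]] <-]; rewrite setTI -[X in measurable X]setTI.
  exact: measurable_Gk.
pose X : {mfun PM R >-> PMc} := HB.pack idc (isMeasurableFun.Build _ _ _ _ _ midc).
have dist_eq : forall C : set PMc, measurable C ->
    distribution Q1 X C = distribution Q2 X C.
  apply: (@probability_ext R _ PMc _ _ _ erefl grid_cylinders_setI).
  by move=> _ [n [A [mA ->]]]; exact: Q12.
move=> B mB.
have mtB : measurable (carried_part @^-1` B : set PMc).
  by rewrite -[X in measurable X]setTI; exact: measurable_carried_part.
have mtB' : measurable (carried_part @^-1` B : set (PM R)).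
  by have := midc measurableT _ mtB; rewrite setTI.
have mc : measurable (carried : set (PM R)).
  by have := midc measurableT _ measurable_carried_cylinder; rewrite setTI.
(* [carried_part] is the identity on [carried], so [B] agrees almost surely with a set of the
   cylinder sigma-algebra, where the laws are known to coincide. *)
have E (Q : probability (PM R) R) : Q carried = 1%E -> Q B = Q (carried_part @^-1` B).
  move=> Qc; apply: eq_measure_ae => //.
  apply: filterS (ae_of_probability1 mc Qc) => m cm.
  by rewrite /preimage/= /carried_part mem_set.
by rewrite (E _ Q1c) (E _ Q2c); exact: (dist_eq _ mtB).
Qed.

Lemma Ik_level0 (i : 'I_(K 0)) : Ik i = I01'.
Proof. by rewrite (ord1 i) /Ik /= mul0r divr1. Qed.

Lemma Delta_Gk_level0 (m : PM R) : Delta R (K 0) (Gk R (K 0) m) <-> carried m.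
Proof.
have mU : (m U2 \is a fin_num)%E by apply: fin_num_measure; exact: measurable_U2.
have E i j : (Gk R (K 0) m : 'M[R]_(K 0)) i j = fine (m U2) by rewrite GkE !Ik_level0.
split=> [[_]|cm].
  under eq_bigr do under eq_bigr do rewrite E.
  by rewrite !big_ord1 => m1; rewrite /carried/= -(fineK mU) m1.
split=> [i j|]; first by rewrite E fine_ge0.
under eq_bigr do under eq_bigr do rewrite E.
by rewrite !big_ord1 (cm : m U2 = 1%E).
Qed.

Lemma carried_of_Gk (Q : probability (PM R) R) (mu1 : probability (mxT R (K 0)) R) :
  mu1 (Delta R (K 0)) = 1%E ->
  (forall A : set (mxT R (K 0)), measurable A -> Q (Gk R (K 0) @^-1` A) = mu1 A) ->
  Q carried = 1%E.
Proof.
move=> mu1D QG; rewrite -mu1D -QG; last exact: measurable_Delta.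
by congr (Q _); apply/seteqP; split => m /Delta_Gk_level0.
Qed.

End Uniqueness.

(** * Approximating measurable partitions by equipartitions of grids *)
Section Equipartition.
Set Implicit Arguments.
Unset Strict Implicit.

(** While some class is too large, another is too small, by counting. Moving one element between
    them changes one label and lowers the total excess by one, so the excess bounds the number of
    changes. *)
Lemma equipartition_repair (T : finType) k q (f : T -> 'I_k) : #|T| = (q * k)%N ->
  exists g : T -> 'I_k, (forall i, #|[set x | g x == i]%SET| = q) /\
    (#|[set x | g x != f x]%SET| <= \sum_i (#|[set x | f x == i]%SET| - q))%N.
Proof.
move=> Tk.
have [E] := ubnP (\sum_i (#|[set x | f x == i]%SET| - q))%N.
elim: E f => // E ih f; rewrite ltnS => fE.
have sumf : (\sum_i #|[set x | f x == i]%SET| = q * k)%N.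
  rewrite -Tk -sum1_card (partition_big f xpredT)//=.
  by apply: eq_bigr => i _; rewrite -sum1_card; apply: eq_bigl => x; rewrite inE.
have [/forallP all_le|/forallPn[i]] := boolP [forall i, #|[set x | f x == i]%SET| <= q]%N.
  exists f; split; last first.
    by rewrite eq_card0// => x; rewrite inE eqxx.
  move=> i; apply/eqP; rewrite eqn_leq all_le/= leqNgt; apply/negP => lti.
  have : (\sum_i #|[set x | f x == i]%SET| < \sum_(i < k) q)%N.
    rewrite (bigD1 i)//= [X in (_ < X)%N](bigD1 i)//= -addSn leq_add//.
    by apply: leq_sum => l _; exact: all_le.
  by rewrite sumf sum_nat_const card_ord mulnC ltnn.
rewrite -ltnNge => qi.
have [j jq] : exists j, (#|[set x | f x == j]%SET| < q)%N.
  apply/existsP; rewrite -[X in is_true X]negbK; apply/existsPn => all_ge.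
  have : (\sum_(i < k) q < \sum_i #|[set x | f x == i]%SET|)%N.
    rewrite (bigD1 i)//= [X in (_ < X)%N](bigD1 i)//= -addSn leq_add//.
    by apply: leq_sum => l _; rewrite leqNgt all_ge.
  by rewrite sumf sum_nat_const card_ord mulnC ltnn.
have ij : i != j by apply/eqP => ij; move: qi jq; rewrite ij; lia.
have [x] : exists x, x \in [set x | f x == i]%SET.
  by apply/set0Pn; rewrite -card_gt0 (leq_trans _ qi).
rewrite inE => /eqP xi.
pose f' y := if y == x then j else f y.
have fi : #|[set y | f y == i]%SET| = #|[set y | f' y == i]%SET|.+1.
  rewrite (cardsD1 x) inE xi eqxx add1n; congr _.+1; apply: eq_card => y.
  rewrite !inE /f'; case: eqP => //= _; first by rewrite eq_sym (negbTE ij).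
have fj : #|[set y | f' y == j]%SET| = #|[set y | f y == j]%SET|.+1.
  rewrite (cardsD1 x) inE /f' eqxx eqxx add1n; congr _.+1; apply: eq_card => y.
  rewrite !inE /f'; case: eqP => //= ->; by rewrite xi (negbTE ij).
have fl l : l != i -> l != j -> #|[set y | f' y == l]%SET| = #|[set y | f y == l]%SET|.
  move=> li lj; apply: eq_card => y; rewrite !inE /f'; case: (y =P x) => // ->.
  by rewrite xi (eq_sym j) (negbTE lj) (eq_sym i) (negbTE li).
have arith a b s : (q < a.+1 -> b < q ->
    a.+1 - q + (b - q + s) = (a - q + (b.+1 - q + s)).+1)%N by lia.
have excess : (\sum_l (#|[set x | f x == l]%SET| - q) =
    (\sum_l (#|[set x | f' x == l]%SET| - q)).+1)%N.
  rewrite (bigD1 i)//= [in RHS](bigD1 i)//= (bigD1 j)/=; last by rewrite eq_sym.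
  rewrite [in RHS](bigD1 j)/=; last by rewrite eq_sym.
  rewrite fj fi (eq_bigr (fun l => #|[set x | f' x == l]%SET| - q)%N); last first.
    by move=> l /andP[li lj]; rewrite fl.
  apply: arith => //; by rewrite -fi.
have [|g [gq gf]] := ih f'; first by rewrite -ltnS -excess.
exists g; split => //; rewrite excess.
apply: (@leq_trans #|(x |: [set x | g x != f' x])%SET|).
  apply: subset_leq_card; apply/fintype.subsetP => y; rewrite !inE /f'.
  by case: (y =P x).
by rewrite (leq_trans (leq_card_setU _ _))// cards1 add1n ltnS.
Qed.

End Equipartition.

Section Approximation.
Set Implicit Arguments.
Unset Strict Implicit.
Variable R : realType.
Local Notation K n := (fact_pred n).+1.
Local Notation I01' := (`[0 : R, 1[%classic).

Definition symdiff (A B : set R) : set R := (A `\` B) `|` (B `\` A).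

Lemma measurable_symdiff A B : measurable A -> measurable B -> measurable (symdiff A B).
Proof. by move=> mA mB; apply: measurableU; exact: measurableD. Qed.

Definition cell_union n (c : pred 'I_(K n)) : set R :=
  \bigcup_(a in [set a | c a]) Ik a.

Lemma measurable_cell_union n (c : pred 'I_(K n)) : measurable (cell_union c).
Proof. by apply: fin_bigcup_measurable => // a _; exact: measurable_Ik. Qed.

Lemma cell_union_refine n m (c : pred 'I_(K n)) : (n <= m)%N ->
  cell_union (fun a : 'I_(K m) => c (block (fact_pred n) a)) = cell_union c.
Proof.
move=> nm; have d := dvdn_fact_pred nm.
apply/seteqP; split => [x [a /= ca ax]|x [a /= ca ax]].
  by exists (block (fact_pred n) a) => //; exact: Ik_block.
have [b bx] := Ik_cover (ltn0Sn (fact_pred m)) (Ik_unit ax).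
by exists b => //=; rewrite -(Ik_inj ax (Ik_block d bx)).
Qed.

Lemma uniform01_unit_ae : {ae (@uniform01 R), forall x : R, 0 <= x < 1}.
Proof.
have : uniform01 I01' = 1%E by rewrite uniform01_itv// subr0.
move=> /(ae_of_probability1 (P := uniform01) (measurable_itv `[0%R, 1%R[)).
by apply: filterS => x; rewrite /= in_itv.
Qed.

Definition grid_approximable (A : set R) := forall e : R, 0 < e ->
  exists n (c : pred 'I_(K n)), (uniform01 (symdiff A (cell_union c)) <= e%:E)%E.

Lemma grid_approximable_setU A B : measurable A -> measurable B ->
  grid_approximable A -> grid_approximable B -> grid_approximable (A `|` B).
Proof.
move=> mA mB gA gB e e0.
have [n [c cA]] := gA _ (divr_gt0 e0 (@ltr0n R 2)).
have [m [c' cB]] := gB _ (divr_gt0 e0 (@ltr0n R 2)).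
pose N := maxn n m.
exists N, (fun a => c (block (fact_pred n) a) || c' (block (fact_pred m) a)).
have -> : cell_union (fun a : 'I_(K N) => c (block (fact_pred n) a) || c' (block (fact_pred m) a))
    = cell_union c `|` cell_union c'.
  rewrite -(cell_union_refine c (leq_maxl n m)) -(cell_union_refine c' (leq_maxr n m)).
  apply/seteqP; split => [x [a /= /orP[ca|ca] ax]|x [] [a /= ca ax]].
  - by left; exists a.
  - by right; exists a.
  - by exists a => //=; rewrite ca.
  - by exists a => //=; rewrite ca orbT.
apply: (@le_trans _ _ (uniform01 (symdiff A (cell_union c) `|` symdiff B (cell_union c')))).
  apply: le_measure; rewrite ?inE.
  - by apply: measurable_symdiff; apply: measurableU => //; exact: measurable_cell_union.
  - by apply: measurableU; apply: measurable_symdiff => //; exact: measurable_cell_union.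
  - move=> x; rewrite /symdiff/=; tauto.
apply: le_trans (measureU2 _ _ _) _.
- by apply: measurable_symdiff => //; exact: measurable_cell_union.
- by apply: measurable_symdiff => //; exact: measurable_cell_union.
by rewrite (splitr e) EFinD; exact: leeD.
Qed.

Lemma grid_approximable_null A B : measurable A -> measurable B ->
  {ae (@uniform01 R), forall x : R, A x <-> B x} -> grid_approximable A -> grid_approximable B.
Proof.
move=> mA mB AB gA e e0; have [n [c cA]] := gA e e0; exists n, c.
apply: le_trans cA; apply: le_measure_ae.
- by apply: measurable_symdiff => //; exact: measurable_cell_union.
- by apply: measurable_symdiff => //; exact: measurable_cell_union.
- by apply: filterS AB => x [h1 h2]; rewrite /symdiff/=; tauto.
Qed.

Lemma grid_approximable_inner (F : (set R)^nat) : (forall n, measurable (F n)) ->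
  nondecreasing_seq F -> (forall n, grid_approximable (F n)) ->
  grid_approximable (\bigcup_n F n).
Proof.
move=> mF ndF gF e e0; have e2 := divr_gt0 e0 (@ltr0n R 2).
have mU : measurable (\bigcup_n F n) by exact: bigcupT_measurable.
have fU : uniform01 (\bigcup_n F n) \is a fin_num by exact: fin_num_measure.
have : uniform01 (F n) @[n --> \oo] --> (fine (uniform01 (\bigcup_n F n)))%:E.
  by rewrite fineK//; exact: nondecreasing_cvg_mu.
move=> /fine_cvgP[_ /cvgrPdist_le /(_ _ e2)] [N _ /(_ N (leqnn N))] /= FN.
have fN : uniform01 (F N) \is a fin_num by exact: fin_num_measure.
have [n [c cN]] := gF N _ e2; exists n, c.
have mc := measurable_cell_union c.
have FU : F N `<=` \bigcup_n F n by move=> x Fx; exists N.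
apply: (@le_trans _ _ (uniform01 (((\bigcup_n F n) `\` F N) `|` symdiff (F N) (cell_union c)))).
  apply: le_measure; rewrite ?inE.
  - exact: measurable_symdiff.
  - by apply: measurableU; [exact: measurableD|exact: measurable_symdiff].
  - by move=> x; have := FU x; have [] := pselect (F N x); rewrite /symdiff/=; tauto.
apply: le_trans (measureU2 _ _ _) _; [exact: measurableD|exact: measurable_symdiff|].
rewrite (splitr e) EFinD; apply: leeD => //.
rewrite measureD//; last by rewrite -ge0_fin_numE.
rewrite (setIidr FU).
change ((uniform01 (\bigcup_n F n) - uniform01 (F N) <= (e / 2)%:E)%E).
rewrite -(fineK fU) -(fineK fN) -EFinB lee_fin.
exact: le_trans (ler_norm _) FN.
Qed.

(** The approximable sets form a Dynkin class containing the rays. Complements select the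
    complementary cells; countable unions are increasing limits of finite ones. *)
Lemma grid_approximable_measurable A : measurable A -> grid_approximable A.
Proof.
move: A; rewrite [X in forall A, X A -> _](ray_generates R).
apply: (@dynkin_induction _ _ (range (fun s : R => `]-oo, s[%classic)) grid_approximable).
- exact: ray_generates.
- exact: rays_setI.
- move=> e e0; exists 0%N, xpredT.
  apply: (@le_trans _ _ (uniform01 (set0 : set R))); last by rewrite measure0 lee_fin ltW.
  apply: le_measure_ae => //.
    by apply: measurable_symdiff => //; exact: measurable_cell_union.
  apply: filterS uniform01_unit_ae => x x01 [[_ h]|[_ h]]; apply: h => //.
  by have [a ax] := Ik_cover (ltn0Sn (fact_pred 0)) x01; exists a.
- move=> _ [s _ <-].
  apply: (@grid_approximable_null (\bigcup_n grid_below n s) _ _ _ _ _) => //.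
  + by apply: bigcupT_measurable => n; exact: measurable_grid_below.
  + apply: filterS uniform01_unit_ae => x x01; rewrite grid_below_bigcup.
    by split => [[]//|xs]; split => //; rewrite /= in_itv.
  apply: (grid_approximable_inner _ _ _).
  + by move=> n; exact: measurable_grid_below.
  + exact: grid_below_nd.
  + move=> n e e0; exists n, (fun a : 'I_(K n) => a.+1%:R / (K n)%:R <= s).
    rewrite (_ : symdiff _ _ = set0) ?measure0 ?lee_fin ?ltW//.
    by apply/seteqP; split => // x [[h1 h2]|[h1 h2]]; exact: h2.
- move=> S mS gS e e0; have [n [c cS]] := gS e e0; exists n, (fun a => ~~ c a).
  apply: le_trans cS; apply: le_measure_ae.
  + by apply: measurable_symdiff; [exact: measurableC|exact: measurable_cell_union].
  + by apply: measurable_symdiff => //; exact: measurable_cell_union.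
  apply: filterS uniform01_unit_ae => x x01.
  have [a ax] := Ik_cover (ltn0Sn (fact_pred n)) x01.
  have E (p : pred 'I_(K n)) : cell_union p x <-> p a.
    split => [[b pb bx]|pa]; last by exists a.
    by rewrite (Ik_inj ax bx).
  move=> [[nS nc]|[/E nca nnS]].
    right; split => //; apply/E; apply: contrapT => /negP nca.
    by apply: nc; apply/E.
  by left; split; [exact: contrapT|move/E; exact/negP].
- move=> F mF tF gF.
  rewrite -(bigcup_bigsetU_bigcup F); apply: (grid_approximable_inner _ _ _).
  + by move=> n; exact: bigsetU_measurable.
  + by move=> n m nm; apply/subsetPset; exact: subset_bigsetU.
  elim => [|n ih]; first by rewrite big_ord_recr/= big_ord0 set0U.
  rewrite big_ord_recr/=; apply: (grid_approximable_setU _ _ _ _) => //.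
  exact: bigsetU_measurable.
Qed.

Lemma grid_approximable_fam (I : finType) (S : I -> set R) (e : R) n0 : 0 < e ->
  (forall i, measurable (S i)) ->
  exists n (c : I -> pred 'I_(K n)), (n0 <= n)%N /\
    forall i, (uniform01 (symdiff (S i) (cell_union (c i))) <= e%:E)%E.
Proof.
move=> e0 mS.
have /choice[nc ncP] : forall i, exists nc : {n & pred 'I_(K n)},
    (uniform01 (symdiff (S i) (cell_union (projT2 nc))) <= e%:E)%E.
  by move=> i; have [n [c h]] := grid_approximable_measurable (mS i) e0; exists (existT _ n c).
pose n := maxn n0 (\max_i projT1 (nc i)).
have le_n i : (projT1 (nc i) <= n)%N by rewrite leq_max (leq_bigmax i) orbT.
exists n, (fun i a => projT2 (nc i) (block (fact_pred (projT1 (nc i))) a)).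
by split => [|i]; [exact: leq_maxl|rewrite cell_union_refine].
Qed.

Lemma uniform01_Ik k (a : 'I_k.+1) : uniform01 (Ik a : set R) = (k.+1%:R^-1)%:E.
Proof.
rewrite /Ik uniform01_itv//.
- by rewrite -mulrBl -natrB// subSnn mul1r.
- by rewrite ler_wpM2r ?invr_ge0// ler_nat.
- by rewrite ler_pdivrMr ?ltr0n// mul1r ler_nat.
Qed.

Lemma uniform01_fiber_union n k (d : 'I_(K n) -> 'I_k) i :
  uniform01 (fiber_union d i : set R) = ((#|[set a | d a == i]%SET|%:R / (K n)%:R)%:E).
Proof.
rewrite (measure_finU _ (fun a => d a == i))//.
- transitivity (\sum_(a | d a == i) ((K n)%:R^-1 : R)%:E)%E.
    by apply: eq_bigr => a _; exact: uniform01_Ik.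
  by rewrite sumEFin sumr_const -[_^-1 *+ _]mulr_natl cardsE.
- by move=> a; exact: measurable_Ik.
- exact: trivIset_Ik.
Qed.

Section MeasurablePartition.
Variables (k : nat) (S : 'I_k.+1 -> set R).
Hypothesis mS : forall i, measurable (S i).
Hypothesis tS : trivIset setT S.
Hypothesis uS : forall i, uniform01 (S i) = (k.+1%:R^-1)%:E.

Lemma partition_cover_ae : {ae (@uniform01 R), forall x : R, exists i, S i x}.
Proof.
have m1 : uniform01 (\bigcup_(i in [set i : 'I_k.+1 | xpredT i]) S i) = 1%E.
  rewrite (measure_finU _ xpredT)//.
  transitivity (\sum_(i < k.+1) (k.+1%:R^-1 : R)%:E)%E.
    by apply: eq_bigr => i _; exact: uS.
  by rewrite sumEFin sumr_const card_ord -[_^-1 *+ _]mulr_natl mulfV// pnatr_eq0.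
have mU : measurable (\bigcup_(i in [set i : 'I_k.+1 | xpredT i]) S i).
  exact: fin_bigcup_measurable.
apply: filterS (ae_of_probability1 (P := uniform01) mU m1) => x [i _ Six].
by exists i.
Qed.

Definition mismatch n (d : 'I_(K n) -> 'I_k.+1) : set R :=
  \bigcup_i symdiff (S i) (fiber_union d i).

Lemma measurable_mismatch n (d : 'I_(K n) -> 'I_k.+1) : measurable (mismatch d).
Proof.
apply: fin_bigcup_measurable => // i _; apply: measurable_symdiff => //.
exact: measurable_fiber_union.
Qed.

Lemma measure_le_sum (F : 'I_k.+1 -> set R) : (forall i, measurable (F i)) ->
  (uniform01 (\bigcup_i F i) <= \sum_i uniform01 (F i))%E.
Proof.
move=> mF; apply: (@le_trans _ _ (\sum_(i \in [set: 'I_k.+1]) uniform01 (F i))%E).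
  apply: content_sub_fsum; [exact: finite_finset|by []| |by []].
  by apply: fin_bigcup_measurable => // i _; exact: mF.
have -> : [set: 'I_k.+1] = [set` index_enum 'I_k.+1].
  by apply/seteqP; split => // i _ /=; exact: mem_index_enum.
by rewrite -fsbig_seq// index_enum_uniq.
Qed.

(** Each class is approximated by cells, and a cell takes the label of some approximation containing
    it. Where no approximation errs, the only approximation containing the cell is that of the true
    class, so the label is right. *)
Lemma mismatch_labelling (e : R) n0 : 0 < e ->
  exists n (d : 'I_(K n) -> 'I_k.+1), (n0 <= n)%N /\ (uniform01 (mismatch d) <= e%:E)%E.
Proof.
move=> e0; have ek : 0 < e / k.+1%:R by rewrite divr_gt0// ltr0n.
have [n [c [n0n cP]]] := grid_approximable_fam n0 ek mS.
(* A cell in no approximation gets the arbitrary label [ord0]; almost every point of it is one where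
   some approximation errs. *)
pose d a := odflt ord0 [pick i | c i a].
exists n, d; split => //.
pose B := \bigcup_i symdiff (S i) (cell_union (c i)).
apply: (@le_trans _ _ (uniform01 B)).
  apply: le_measure_ae; first exact: measurable_mismatch.
    apply: fin_bigcup_measurable => // i _; apply: measurable_symdiff => //.
    exact: measurable_cell_union.
  have ae2 : {ae (@uniform01 R), forall x : R, 0 <= x < 1 /\ exists i, S i x}.
    by apply: filterS2 uniform01_unit_ae partition_cover_ae.
  apply: filterS ae2 => x [x01 [i Six]].
  have [a ax] := Ik_cover (ltn0Sn (fact_pred n)) x01.
  apply: contraPP => nB [l _ Sl]; apply: nB.
  have cE j : cell_union (c j) x <-> c j a.
    split => [[b pb bx]|pa]; last by exists a.
    by rewrite (Ik_inj ax bx).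
  have [nci|cia] := boolP (~~ c i a).
    by exists i => //; left; split => // /cE; apply/negP.
  have {}cia : c i a by rewrite -[c i a]negbK.
  have [/existsP[j /andP[cj ji]]|] := boolP [exists j, c j a && (j != i)].
    exists j => //; right; split; first exact/cE.
    by move=> Sj; move/eqP: ji; apply; apply: (tS I I); exists x.
  move=> /existsPn nj; exfalso.
  have da : d a = i.
    rewrite /d; case: pickP => [j cj|/(_ i)]; last by rewrite cia.
    by apply/eqP; have := nj j; rewrite cj/= negbK.
  have fE j : fiber_union d j x <-> i = j.
    split => [[b /= /eqP <- bx]|<-]; last by exists a => //=; rewrite da.
    by rewrite -(Ik_inj ax bx).
  case: Sl => -[h1 h2]; first by apply: h2; apply/fE; apply: (tS I I); exists x.
  by apply: h2; rewrite -((fE l).1 h1).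
apply: (le_trans (measure_le_sum _)).
  by move=> i; apply: measurable_symdiff => //; exact: measurable_cell_union.
apply: (@le_trans _ _ (\sum_(i < k.+1) (e / k.+1%:R)%:E)%E).
  by apply: lee_sum => i _; exact: cP.
by rewrite sumEFin sumr_const card_ord -[(_ / _) *+ _]mulr_natl mulrC divfK// pnatr_eq0.
Qed.

Lemma mismatch_equipartition (e : R) n0 : 0 < e -> (k < n0)%N ->
  exists n (d : 'I_(K n) -> 'I_k.+1), [/\ (n0 <= n)%N,
    (forall i, #|[set v | d v == i]%SET| = (K n %/ k.+1)%N) &
    (uniform01 (mismatch d) <= e%:E)%E].
Proof.
(* One share of [e] pays for the mismatch of the labelling [f], and [k.+1] shares for the cells
   relabelled in the repair, one per class. *)
move=> e0 kn0; have ek : 0 < e / k.+2%:R by rewrite divr_gt0// ltr0n.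
have [n [f [n0n fP]]] := mismatch_labelling n0 ek.
set eta := e / _ in fP ek.
have kK : (k.+1 %| K n)%N by apply: dvdn_fact_pred_lt; exact: leq_trans n0n.
have [|d [dq df]] := @equipartition_repair 'I_(K n) k.+1 (K n %/ k.+1) f.
  by rewrite card_ord divnK.
exists n, d; split => //.
have Kn0 : 0 < (K n)%:R :> R by rewrite ltr0n.
(* A label union lies in [S i] together with the mismatch, so it exceeds its due measure
   [1 / (k + 1)] by at most [eta]. *)
have excess i : ((#|[set x | f x == i]%SET| - K n %/ k.+1)%N%:R / (K n)%:R <= eta :> R).
  have [le|lt] := leqP #|[set x | f x == i]%SET| (K n %/ k.+1).
    by move/eqP: le => ->; rewrite mul0r ltW.
  rewrite natrB ?(ltnW lt)// mulrBl.
  have -> : (K n %/ k.+1)%N%:R / (K n)%:R = k.+1%:R^-1 :> R.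
    rewrite -[X in _ / X%:R](divnK kK) natrM invfM mulrA mulfV ?mul1r//.
    by rewrite pnatr_eq0 -lt0n divn_gt0// dvdn_leq.
  rewrite -lee_fin EFinB -(uniform01_fiber_union f i) -(uS i) leeBlDr ?fin_num_measure//.
  apply: (@le_trans _ _ (uniform01 (mismatch f `|` S i))).
    apply: le_measure; rewrite ?inE.
    - exact: measurable_fiber_union.
    - by apply: measurableU => //; exact: measurable_mismatch.
    - move=> x fx; have [Sx|nSx] := pselect (S i x); first by right.
      by left; exists i => //; right.
  apply: le_trans (measureU2 _ _ _) _ => //; first exact: measurable_mismatch.
  by rewrite leeD2r.
pose C := \bigcup_(a in [set a | d a != f a]) (Ik a : set R).
have mC : measurable C by apply: fin_bigcup_measurable => // a _; exact: measurable_Ik.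
have Cle : (uniform01 C <= (k.+1%:R * eta)%:E)%E.
  rewrite (measure_finU _ (fun a => d a != f a)).
  - apply: (@le_trans _ _ (\sum_(a | d a != f a) ((K n)%:R^-1 : R)%:E)%E).
      apply: lee_sum => a _; rewrite le_eqVlt; apply/orP; left; apply/eqP.
      exact: uniform01_Ik.
    rewrite sumEFin sumr_const lee_fin -cardsE -[_^-1 *+ _]mulr_natl.
    apply: (@le_trans _ _ ((\sum_i (#|[set x | f x == i]%SET| - K n %/ k.+1))%N%:R / (K n)%:R)).
      by rewrite ler_wpM2r ?invr_ge0// ler_nat.
    rewrite natr_sum mulr_suml.
    apply: (@le_trans _ _ (\sum_(i < k.+1) eta)); first by apply: ler_sum => i _; exact: excess.
    by rewrite sumr_const card_ord mulr_natl.
  - by move=> a; exact: measurable_Ik.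
  - exact: trivIset_Ik.
apply: (@le_trans _ _ (uniform01 (mismatch f `|` C))).
  apply: le_measure; rewrite ?inE.
  - exact: measurable_mismatch.
  - by apply: measurableU => //; exact: measurable_mismatch.
  move=> x [i _ Sd]; have [Cx|nC] := pselect (C x); first by right.
  left; exists i => //.
  have E : fiber_union d i x <-> fiber_union f i x.
    split => -[a /= /eqP ai ax]; exists a => //=; apply/eqP; rewrite -ai.
      by apply/esym/eqP/negPn/negP => da; apply: nC; exists a.
    by apply/eqP/negPn/negP => da; apply: nC; exists a.
  by move: Sd; rewrite /symdiff/=; tauto.
apply: le_trans (measureU2 _ _ _) _ => //; first exact: measurable_mismatch.
rewrite (_ : e%:E = (eta%:E + (k.+1%:R * eta)%:E)%E); first exact: leeD.
have etaE : eta * k.+2%:R = e by rewrite /eta divfK// pnatr_eq0.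
by rewrite -EFinD -etaE -(natr1 k.+1) mulrDr mulr1 addrC [eta * _]mulrC.
Qed.

End MeasurablePartition.

End Approximation.

(** * The random measure and its exchangeability *)
Section RandomMeasure.
Set Implicit Arguments.
Unset Strict Implicit.
Variables (R : realType) (phi : R * R -> R * R).
Hypothesis mphi : measurable_fun setT phi.

Lemma measurable_section u : measurable_fun setT (fun v : R => phi (u, v)).
Proof. by apply: measurableT_comp => //; exact: pair1_measurable. Qed.

Definition section_mfun u : {mfun R >-> (R * R)%type} :=
  HB.pack (fun v : R => phi (u, v)) (isMeasurableFun.Build _ _ _ _ _ (measurable_section u)).

Definition random_measure (u : R) : PM R := distribution uniform01 (section_mfun u).

Lemma random_measureE u (A : set (R * R)) :
  random_measure u A = uniform01 [set v | A (phi (u, v))].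
Proof. by []. Qed.

Lemma measurable_phi_preimage (A : set (R * R)) : measurable A -> measurable (phi @^-1` A).
Proof. by move=> mA; rewrite -[X in measurable X]setTI; exact: mphi. Qed.

Lemma random_measure_xsection u (A : set (R * R)) :
  random_measure u A = uniform01 (xsection (phi @^-1` A) u).
Proof.
rewrite random_measureE; congr (uniform01 _).
by apply/seteqP; split => v; rewrite /xsection/= inE.
Qed.

Lemma measurable_random_measure_ev (A : set (R * R)) : measurable A ->
  measurable_fun setT (fun u => random_measure u A).
Proof.
move=> mA; under eq_fun do rewrite random_measure_xsection.
apply: measurable_fun_xsection; exact: measurable_phi_preimage.
Qed.

Lemma measurable_random_measure : measurable_fun setT random_measure.
Proof.
apply: (@measurability _ _ _ (PM R) setT _ (@pset _ (R * R)%type R) erefl).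
move=> _ [_ [r _ [A mA <-]] <-].
have := measurable_random_measure_ev mA measurableT (emeasurable_itv `]-oo, r%:E[).
by rewrite preimage_itvNyo.
Qed.

Definition random_measure_mfun : {mfun R >-> PM R} :=
  HB.pack random_measure (isMeasurableFun.Build _ _ _ _ _ measurable_random_measure).

Definition random_measure_law : probability (PM R) R :=
  distribution uniform01 random_measure_mfun.

Lemma random_measure_lawE (B : set (PM R)) :
  random_measure_law B = uniform01 [set u | B (random_measure u)].
Proof. by []. Qed.

Lemma random_measure_mean (A : set (R * R)) : measurable A ->
  square01 (phi @^-1` A) = (\int[uniform01]_u random_measure u A)%E.
Proof.
by move=> mA; apply: eq_integral => u _; rewrite random_measure_xsection.
Qed.

Lemma random_measure_markov (A : set (R * R)) (c : R) : measurable A -> 0 < c ->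
  (c%:E * random_measure_law [set m : PM R | c%:E <= m A] <= square01 (phi @^-1` A))%E.
Proof.
move=> mA c0; rewrite random_measure_lawE random_measure_mean//.
pose B := [set u | (c%:E <= random_measure u A)%E].
have mB : measurable B.
  have := measurable_random_measure_ev mA measurableT (emeasurable_itv `[c%:E, +oo[).
  rewrite setTI [X in measurable X -> _](_ : _ = B)//.
  apply/seteqP; split => u; rewrite /B/= in_itv/= andbT//.
apply: (@le_trans _ _ (\int[uniform01]_(u in B) random_measure u A)%E).
  rewrite -integral_cst//; apply: ge0_le_integral => //.
  - by move=> u _; rewrite lee_fin ltW.
  - by apply: measurable_funTS; exact: measurable_random_measure_ev.
by apply: ge0_subset_integral => //; exact: measurable_random_measure_ev.
Qed.

End RandomMeasure.

(** [is_push] fixes the pushed measure on measurable sets only. The sigma-algebra on [PM] is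
    generated by evaluations at such sets, so its members cannot separate two versions of it. *)
Lemma measurable_PM_saturated (R : realType) (B : set (PM R)) : measurable B ->
  forall m m' : PM R, (forall A, measurable A -> m A = m' A) -> B m -> B m'.
Proof.
move=> mB; suff : forall m m' : PM R,
    (forall A, measurable A -> m A = m' A) -> B m <-> B m'.
  by move=> h m m' mm' /(h _ _ mm').
move: B mB; apply: smallest_sub; last first.
  move=> _ [r _ [A mA <-]] m m' mm'; rewrite /mset/=; by rewrite mm'.
split.
- by [].
- by move=> B hB m m' mm'; rewrite setTD /setC/=; split => h /(hB m m' mm') /h.
- move=> F hF m m' mm'; split => -[n _ Fm]; exists n => //.
    exact/(hF n m m' mm').
  exact/(hF n m m' mm').
Qed.

(** * Existence: the law of the random measure *)

Section Existence.
Set Implicit Arguments.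
Unset Strict Implicit.
Variables (R : realType) (mu : forall k : nat, probability (mxT R k) R).
Hypothesis mu_consistent : eq_consistent_model mu.
Local Notation K n := (fact_pred n).+1.

Let X := @limit_matrix R mu.
Let mX := @measurable_limit_matrix R mu.
Let lX := @limit_matrix_law R mu mu_consistent.
Let cX := @limit_matrix_consistent R mu mu_consistent.

Definition sample_point (z : R * R) : R * R :=
  (sample_coord X false z.1 z.2, sample_coord X true z.1 z.2).

Lemma measurable_sample_point : measurable_fun setT sample_point.
Proof. by apply: measurable_fun_pair; exact: measurable_sample_coord. Qed.

Local Notation M := (random_measure measurable_sample_point).
Local Notation Q := (random_measure_law measurable_sample_point).

(** For almost every [u], the point lies in a cell exactly when [sample_cell] is that cell, for
    almost every [v]; the probability of the latter is the entry of [X n u]. *)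
Lemma Gk_random_measure : {ae uniform01, forall u, forall n, Gk R (K n) (M u) = X n u}.
Proof.
have h := ae_section (Q := fun u v => forall b n (a : 'I_(K n)),
  @Ik R _ a (sample_coord X b u v) <-> coord b (sample_cell X n u v) = a)
  (coord_sample_coord mu_consistent mX lX cX).
apply: filterS2 h (valid_sample_ae mu_consistent mX lX cX) => u hu vu n.
apply/matrixP => a c; rewrite GkE; apply: EFin_inj; rewrite fineK; last first.
  by apply: fin_num_measure; apply: measurableX; exact: measurable_Ik.
rewrite -(sample_cell_law mX (a, c) vu) random_measureE.
apply: eq_measure_ae.
- have mac : measurable (Ik a `*` Ik c : set (R * R)).
    by apply: measurableX; exact: measurable_Ik.
  by have := measurable_section measurable_sample_point u measurableT mac; rewrite setTI.
- exact: (measurable_path_word_section mX n.+1 u [set s | cell_of n s = (a, c)]).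
apply: filterS hu => v hv /=; split => [[/(hv false) h1 /(hv true) h2]|h1].
  by rewrite [LHS]surjective_pairing; congr pair.
by split; [apply/(hv false)|apply/(hv true)]; rewrite h1.
Qed.

Lemma Gk_law n (A : set (mxT R (K n))) : measurable A ->
  Q (Gk R (K n) @^-1` A) = mu (K n) A.
Proof.
move=> mA; rewrite -lX// random_measure_lawE; apply: eq_measure_ae.
- have mG : measurable (Gk R (K n) @^-1` A).
    by rewrite -[X in measurable X]setTI; exact: measurable_Gk.
  by have := measurable_random_measure measurable_sample_point measurableT mG; rewrite setTI.
- by rewrite -[X in measurable X]setTI; exact: mX.
by apply: filterS Gk_random_measure => u /= ->.
Qed.

Lemma sample_coord_uniform b (Y : set R) : measurable Y ->
  square01 [set z | Y (sample_coord X b z.1 z.2)] = uniform01 Y.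
Proof.
pose x : {mfun (R * R)%type >-> R} := HB.pack (fun z : R * R => sample_coord X b z.1 z.2)
  (isMeasurableFun.Build _ _ _ _ _ (measurable_sample_coord mX b)).
pose law_x : probability R R := distribution square01 x.
have cell_measure n (a : 'I_(K n)) : law_x (Ik a) = ((K n)%:R^-1)%:E.
  rewrite -(coord_law mu_consistent mX lX cX b a).
  transitivity (square01 [set z | Ik a (sample_coord X b z.1 z.2)]); first by [].
  apply: eq_measure_ae.
  - exact: (measurable_sample_coord_set mX b (measurable_Ik a)).
  - exact: (measurable_sample_cell mX [set e : cell n | coord b e = a]).
  by apply: filterS (coord_sample_coord mu_consistent mX lX cX) => z /(_ b n a).
move: Y; apply: (@grid_probability_unique R law_x uniform01).
- by move=> n a; rewrite [RHS]uniform01_Ik; exact: cell_measure.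
- by rewrite -(Ik_level0 R ord0); apply: (etrans (cell_measure 0%N ord0)); rewrite invr1.
- by rewrite [LHS]uniform01_itv// subr0.
Qed.

Section Partition.
Variables (k : nat) (S : 'I_k.+1 -> set R).
Hypothesis mS : forall i, measurable (S i).
Hypothesis tS : trivIset setT S.
Hypothesis uS : forall i, uniform01 (S i) = (k.+1%:R^-1)%:E.

Definition partition_matrix (m : PM R) : mxT R k.+1 :=
  \matrix_(i, j) fine (m (S i `*` S j)).

Lemma measurable_partition_matrix : measurable_fun setT partition_matrix.
Proof.
apply: measurable_mxT => i j; under eq_fun do rewrite mxE.
apply: measurableT_comp => //; apply: measurable_ev.
exact: measurableX.
Qed.

Lemma fine_measure_le_add (m : PM R) (A B C D : set (R * R)) (e : R) :
  measurable A -> measurable B -> measurable C -> measurable D ->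
  A `<=` B `|` (C `|` D) -> (m C <= (e / 2)%:E)%E -> (m D <= (e / 2)%:E)%E ->
  fine (m A) <= fine (m B) + e.
Proof.
move=> mA mB mC mD AB mCe mDe; rewrite -lee_fin EFinD !fineK; last 2 first.
  exact: fin_num_measure.
  exact: fin_num_measure.
apply: (@le_trans _ _ (m (B `|` (C `|` D)))).
  by apply: le_measure; rewrite ?inE//; apply: measurableU => //; exact: measurableU.
apply: le_trans (measureU2 _ _ _) _ => //; first exact: measurableU.
rewrite leeD2l//; apply: le_trans (measureU2 _ _ _) _ => //.
by rewrite (splitr e) EFinD; exact: leeD.
Qed.

Lemma partition_matrix_law (A : set (mxT R k.+1)) : measurable A ->
  Q (partition_matrix @^-1` A) = mu k.+1 A.
Proof.
move: A; pose Y : {mfun PM R >-> mxT R k.+1} :=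
  HB.pack partition_matrix (isMeasurableFun.Build _ _ _ _ _ measurable_partition_matrix).
(* It suffices to find variables with the exact law that are arbitrarily close in probability;
   [law_approx] does the rest. *)
suff approx e : 0 < e -> exists Yd : PM R -> mxT R k.+1,
    [/\ measurable_fun setT Yd,
     forall A : set (mxT R k.+1), measurable A -> Q (Yd @^-1` A) = mu k.+1 A &
     exists B : set (PM R), [/\ measurable B, (Q B <= e%:E)%E &
       forall m, ~ B m -> forall i j,
         (partition_matrix m : 'M[R]_k.+1) i j <= (Yd m : 'M[R]_k.+1) i j + e /\
         (Yd m : 'M[R]_k.+1) i j <= (partition_matrix m : 'M[R]_k.+1) i j + e]].
  have mpre (F : PM R -> mxT R k.+1) t : measurable_fun setT F ->
      measurable (F @^-1` lower_set t).
    by move=> mF; rewrite -[X in measurable X]setTI; apply: mF => //; exact: measurable_lower_set.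
  have mP := mpre _ _ measurable_partition_matrix.
  apply: (@law_approx _ _ (distribution Q Y) (mu k.+1)) => t e /approx[Yd [mYd lYd [B [mB QB close]]]].
    rewrite -lYd; last exact: measurable_lower_set.
    change (Q (partition_matrix @^-1` lower_set t) <=
      Q (Yd @^-1` lower_set (shift_mx t e)) + e%:E)%E.
    apply: (@le_trans _ _ (Q (Yd @^-1` lower_set (shift_mx t e) `|` B))).
      apply: le_measure; rewrite ?inE//; first by apply: measurableU => //; exact: mpre.
      move=> m mt; have [Bm|nB] := pselect (B m); first by right.
      left=> i j; rewrite shift_mxE (le_trans (close m nB i j).2)// lerD2r.
      exact: mt.
    apply: le_trans (measureU2 _ _ _) _ => //; first exact: mpre.
    by rewrite leeD2l.
  rewrite -lYd; last exact: measurable_lower_set.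
  change (Q (Yd @^-1` lower_set t) <=
    Q (partition_matrix @^-1` lower_set (shift_mx t e)) + e%:E)%E.
  apply: (@le_trans _ _ (Q (partition_matrix @^-1` lower_set (shift_mx t e) `|` B))).
    apply: le_measure; rewrite ?inE//; [exact: mpre|by apply: measurableU|].
    move=> m mt; have [Bm|nB] := pselect (B m); first by right.
    left=> i j; rewrite shift_mxE (le_trans (close m nB i j).1)// lerD2r.
    exact: mt.
  apply: le_trans (measureU2 _ _ _) _ => //.
  by rewrite leeD2l.
move=> e0; have e2 : 0 < e / 2 by rewrite divr_gt0.
(* With mismatch at most [(e / 2) ^ 2], Markov at threshold [e / 2] bounds the probability of a
   heavy strip by [e / 2]; there are two strips. *)
have ee : 0 < (e / 2) * (e / 2) by rewrite mulr_gt0.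
have [n [d [kn dq mis]]] := mismatch_equipartition mS tS uS ee (ltnSn k).
have kK : (k.+1 %| K n)%N by apply: dvdn_fact_pred_lt; exact: kn.
pose D := mismatch S d.
have mD : measurable D by exact: measurable_mismatch.
exists (fun m => rho d (Gk R (K n) m)); split.
- by apply: measurableT_comp; [exact: measurable_rho|exact: measurable_Gk].
(* The law is exact, not approximate, because [d] is an equipartition: this is why the labelling had
   to be repaired. *)
- move=> A mA; rewrite -(@mu_rho R mu mu_consistent (K n) k.+1 d (K n %/ k.+1))//; last 2 first.
    by rewrite divn_gt0// dvdn_leq.
    by rewrite divnK.
  rewrite -Gk_law//; rewrite -[X in measurable X]setTI.
  exact: measurable_rho.
pose B1 := [set m : PM R | ((e / 2)%:E <= m (D `*` setT))%E].
pose B2 := [set m : PM R | ((e / 2)%:E <= m (setT `*` D))%E].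
have mDx : measurable (D `*` [set: R]) by exact: measurableX.
have mDy : measurable ([set: R] `*` D) by exact: measurableX.
have mBx (C : set (R * R)) : measurable C -> measurable [set m : PM R | ((e / 2)%:E <= m C)%E].
  move=> mC; have := measurable_ev mC measurableT (emeasurable_itv `[(e / 2)%:E, +oo[).
  rewrite setTI [X in measurable X -> _](_ : _ = [set m : PM R | ((e / 2)%:E <= m C)%E])//.
  by apply/seteqP; split => m; rewrite /= in_itv/= andbT.
have QB (C : set (R * R)) : measurable C -> square01 (sample_point @^-1` C) = uniform01 D ->
    (Q [set m : PM R | ((e / 2)%:E <= m C)%E] <= (e / 2)%:E)%E.
  move=> mC CD; have := random_measure_markov measurable_sample_point mC e2.
  rewrite CD => /le_trans /(_ mis).
  by rewrite (EFinM (e / 2) (e / 2)) lee_pmul2l// lte_fin.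
exists (B1 `|` B2); split.
- by apply: measurableU; exact: mBx.
- apply: le_trans (measureU2 _ _ _) _; [exact: mBx|exact: mBx|].
  rewrite (splitr e) EFinD; apply: leeD; apply: QB => //.
    rewrite -(sample_coord_uniform false mD); congr (square01 _).
    by apply/seteqP; split => z /=; [case|].
  rewrite -(sample_coord_uniform true mD); congr (square01 _).
  by apply/seteqP; split => z /=; [case|].
move=> m nB i j.
have m1 : (m (D `*` setT) <= (e / 2)%:E)%E.
  by rewrite leNgt; apply/negP => /ltW h; apply: nB; left.
have m2 : (m (setT `*` D) <= (e / 2)%:E)%E.
  by rewrite leNgt; apply/negP => /ltW h; apply: nB; right.
have mf l : measurable (fiber_union d l : set R) by exact: measurable_fiber_union.
have SD l x : S l x -> fiber_union d l x \/ D x.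
  move=> Sx; have [fx|nfx] := pselect (fiber_union d l x); first by left.
  by right; exists l => //; left.
have DS l x : fiber_union d l x -> S l x \/ D x.
  move=> fx; have [Sx|nSx] := pselect (S l x); first by left.
  by right; exists l => //; right.
rewrite rho_Gk mxE; split; apply: (fine_measure_le_add _ _ mDx mDy) => //;
  try exact: measurableX.
  move=> [x y] [/= /SD[fx|Dx] /SD[fy|Dy]]; [by left|by right; right|by right; left|by right; left].
move=> [x y] [/= /DS[fx|Dx] /DS[fy|Dy]]; [by left|by right; right|by right; left|by right; left].
Qed.

End Partition.

Lemma law_carried : Q (@carried R) = 1%E.
Proof.
apply: (@carried_of_Gk R Q (mu (K 0))); first exact: mu_consistent.1.
exact: Gk_law.
Qed.

Lemma measurable_ext01 (s : R -> R) : measurable_fun (I01 R) s -> measurable_fun setT (ext01 R s).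
Proof.
move=> ms _ Y mY; have mI : measurable (I01 R) by exact: measurable_itv.
rewrite setTI [X in measurable X](_ : _ = (I01 R `&` s @^-1` Y) `|` (~` I01 R `&` Y)).
  apply: measurableU; first exact: ms.
  by apply: measurableI => //; exact: measurableC.
apply/seteqP; split => x; rewrite /ext01 /=.
  by case: ifPn => [/set_mem Ix sx|/negP nIx Yx]; [left|right; split => // /mem_set].
by move=> [[Ix sx]|[nIx Yx]]; [rewrite mem_set|rewrite memNset].
Qed.

Lemma uniform01_lmp (s : R -> R) (A : set R) : lmp_bij R s -> measurable A ->
  A `<=` `[0, 1[%classic -> uniform01 (ext01 R s @^-1` A) = uniform01 A.
Proof.
move=> [_ [ms leb]] mA A01.
have AI : A `<=` I01 R.
  by move=> x /A01; rewrite /I01/= !in_itv/= => /andP[-> /ltW].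
transitivity (lebesgue_measure (I01 R `&` s @^-1` A)); last first.
  by rewrite leb// /uniform01 setIidl.
rewrite /uniform01; apply: (@eq_measure_ae _ _ _ (@lebesgue_measure R)).
- apply: measurableI; last exact: measurable_itv.
  by have := measurable_ext01 ms measurableT mA; rewrite setTI.
- by apply: ms => //; exact: measurable_itv.
(* The closed and the half-open unit interval differ in the null point [1]. *)
exists [set 1]; split; [exact: measurable_set1|exact: lebesgue_measure_set1|].
move=> x /= nx; apply: contrapT => /eqP x1; apply: nx.
rewrite /I01/= !in_itv/= /ext01; split.
  move=> [+ /andP[x0 xl1]]; rewrite mem_set; first by rewrite x0 ltW.
  by rewrite /I01/= in_itv/= x0 ltW.
move=> [/andP[x0 xl1] sx]; rewrite x0 lt_neqAle x1 xl1; split => //.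
by rewrite mem_set// /I01/= in_itv/= x0.
Qed.

Lemma law_exchangeable : exchangeable Q.
Proof.
move=> s lmp B mB; have mext := measurable_ext01 lmp.2.1.
have mT : measurable_fun setT (Tsq R s).
  by apply: measurable_fun_pair; apply: measurableT_comp.
pose T : {mfun (R * R)%type >-> (R * R)%type} :=
  HB.pack (Tsq R s) (isMeasurableFun.Build _ _ _ _ _ mT).
pose push (m : PM R) : PM R := distribution m T.
have mpush : measurable_fun setT push.
  apply: (@measurability _ _ (PM R) (PM R) setT _ (@pset _ (R * R)%type R) erefl).
  move=> _ [_ [r _ [A mA <-]] <-].
  have mTA : measurable (Tsq R s @^-1` A).
    by have := mT measurableT _ mA; rewrite setTI.
  have := measurable_ev mTA measurableT (emeasurable_itv `]-oo, r%:E[).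
  by rewrite preimage_itvNyo.
pose P : {mfun PM R >-> PM R} := HB.pack push (isMeasurableFun.Build _ _ _ _ _ mpush).
have -> : [set m | exists m', is_push R s m m' /\ B m'] = push @^-1` B.
  apply/seteqP; split => m; last by move=> Bm; exists (push m).
  move=> [m' [mm' Bm']]; apply: (measurable_PM_saturated mB) Bm' => A mA.
  by rewrite mm'.
(* The grid matrices of the pushed measure are the partition matrices of [m] for these preimages,
   whose measure [1 / K n] is preserved by [s]. *)
pose S n (i : 'I_(K n)) : set R := ext01 R s @^-1` Ik i.
have push_law n (A : set (mxT R (K n))) : measurable A ->
    distribution Q P (Gk R (K n) @^-1` A) = mu (K n) A.
  move=> mA; rewrite -(@partition_matrix_law _ (S n))//.
  - by move=> i; rewrite -[X in measurable X]setTI; apply: mext => //; exact: measurable_Ik.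
  - by move=> i j _ _ [x [/= xi xj]]; exact: Ik_inj xi xj.
  - move=> i; rewrite (uniform01_lmp lmp (measurable_Ik i)); first exact: uniform01_Ik.
    by move=> x /Ik_unit; rewrite /= in_itv.
apply: (@random_measure_unique R (distribution Q P) Q) => //.
- by move=> n A mA; rewrite Gk_law//; exact: push_law.
- by apply: (@carried_of_Gk R _ (mu (K 0))); [exact: mu_consistent.1|exact: push_law].
- exact: law_carried.
Qed.

Lemma measurable_ev1 (A : set (R * R)) : measurable A -> measurable [set m : PM R | m A = 1%E].
Proof.
by move=> mA; have := measurable_ev mA measurableT (emeasurable_set1 1%E); rewrite setTI.
Qed.

Lemma law_represents : represents mu Q.
Proof.
have munit : measurable (unit_sq R) by apply: measurableX; exact: measurable_itv.
split; [|split; first exact: law_exchangeable].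
  apply/eqP; rewrite eq_le probability_le1/=; last exact: measurable_ev1.
  rewrite -[X in (X <= _)%E]law_carried; apply: le_measure; rewrite ?inE.
  - by apply: measurable_ev1; exact: measurable_U2.
  - exact: measurable_ev1.
  move=> m cm; apply/eqP; rewrite eq_le probability_le1//= -[X in (X <= _)%E](cm : _ = 1%E).
  apply: le_measure; rewrite ?inE//; first exact: measurable_U2.
  move=> [x y] [/=]; rewrite /unit_sq /I01 /= !in_itv/=.
  by move=> /andP[-> /ltW ->] /andP[-> /ltW ->].
(* The grid of mesh [1 / (k + 1)] need not be a factorial one, but its cells are a partition to
   which [partition_matrix_law] applies. *)
move=> [//|k] _ A mA; rewrite -(@partition_matrix_law k (@Ik R k.+1))//.
- by move=> i; exact: measurable_Ik.
- exact: trivIset_Ik.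
- by move=> i; exact: uniform01_Ik.
Qed.

End Existence.

Lemma represents_unique (R : realType) (mu : forall k : nat, probability (mxT R k) R)
    (Q1 Q2 : probability (PM R) R) : eq_consistent_model mu ->
  represents mu Q1 -> represents mu Q2 ->
  forall B : set (PM R), measurable B -> Q1 B = Q2 B.
Proof.
move=> mu_consistent [_ [_ G1]] [_ [_ G2]].
apply: random_measure_unique.
- by move=> n A mA; rewrite G1// G2.
- apply: (@carried_of_Gk R Q1 (mu (fact_pred 0).+1)); first exact: mu_consistent.1.
  by move=> A mA; exact: G1.
- apply: (@carried_of_Gk R Q2 (mu (fact_pred 0).+1)); first exact: mu_consistent.1.
  by move=> A mA; exact: G2.
Qed.

Theorem mainTheorem19 (R : realType)
  (mu : forall k : nat, probability (mxT R k) R) :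
  eq_consistent_model mu ->
  (exists Q : probability (PM R) R, represents mu Q) /\
  (forall Q1 Q2 : probability (PM R) R, represents mu Q1 -> represents mu Q2 ->
     forall B : set (PM R), measurable B -> Q1 B = Q2 B).
Proof.
move=> mu_consistent; split.
  by eexists; exact: law_represents mu_consistent.
by move=> Q1 Q2; exact: represents_unique.
Qed.
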